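(* Let $D^n_m$ be a Dutch windmill graph. Then $$\mathrm{M}(D^n_m)\simeq\begin{cases} * & \text{if } m=3k,\\ \mathbb{S}^{nk-1} & \text{if } m=3k+1,\\ \bigvee^{2n-1}\mathbb{S}^{nk} & \text{if } m=3k+2.\end{cases}$$
   Context: For $m\ge 3$, the cycle $C_m$ is the graph with vertices $v_0,\ldots,v_{m-1}$ and edges $\{v_0,v_1\},\{v_1,v_2\},\ldots,\{v_{m-2},v_{m-1}\},\{v_{m-1},v_0\}$. The Dutch windmill graph $D^n_m$ is obtained by taking $n$ copies of the cycle $C_m$ and joining them at a common vertex. The matching complex $\mathrm{M}(G)$ of a graph $G$ is the simplicial complex whose vertices are the edges of $G$ and whose faces are the matchings of $G$, where a matching is a set $H$ of edges of $G$ such that every vertex has degree at most $1$ in $H$ (no two edges of $H$ share a vertex). Here $k$ is an integer, $\simeq$ denotes homotopy equivalence, $*$ denotes a point, $\mathbb{S}^d$ is the $d$-sphere, and $\bigvee^{r}\mathbb{S}^d$ is the wedge of $r$ copies of $\mathbb{S}^d$.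
   Formalization: The number of copies n is taken to be at least 1, and in the case m=3k at least 2: for n=1 the graph is the cycle C_{3k}, whose matching complex is not contractible (for C_3 it is three isolated points). *)

(* Defs.v *)
From HB Require Import structures.
From mathcomp Require Import all_boot all_order all_algebra.

Set Implicit Arguments.
Unset Strict Implicit.
Unset Printing Implicit Defensive.

Import Order.TTheory GRing.Theory Num.Theory.

(** A finite simple graph on the vertex type [T] is given by its set of edges,
    each edge being a two-element subset of [T]. *)

Definition cycle_edges (m : nat) : {set {set 'I_m}} :=
  [set [set i; ordS i] | i : 'I_m].

(** [None] is the common vertex, with which the vertex 0 of every copy of the
    cycle is identified; [Some (i, j)] is the vertex [j != 0] of copy [i]. *)
Definition windmill_vertex (m n : nat) : finType :=
  option ('I_n * {j : 'I_m | val j != 0}).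

(** [insub j] is [None] exactly when [j] is the vertex 0. *)
Definition windmill_copy (m n : nat) (i : 'I_n) (j : 'I_m) :
    windmill_vertex m n :=
  omap (pair i) (insub j).

Definition windmill_edges (m n : nat) : {set {set windmill_vertex m n}} :=
  [set (windmill_copy i) @: e 
     | i : 'I_n, e : {set 'I_m} in cycle_edges m].

Lemma card_cycle_edge (m : nat) (e : {set 'I_m}) :
  3 <= m -> e \in cycle_edges m -> #|e| = 2.
Proof.
move=> m3 /imsetP[i _ ->]; rewrite cards2 -val_eqE /=.
have im := ltn_ord i; case: (ltnP i.+1 m) => im1.
  by rewrite modn_small// neq_ltn leqnn.
have iE : i.+1 = m by apply/eqP; rewrite eqn_leq im.
by rewrite iE modnn -lt0n -ltnS iE (leq_trans _ m3).
Qed.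

Lemma windmill_copy_inj (m n : nat) (i : 'I_n) :
  injective (@windmill_copy m n i).
Proof.
move=> j j'; rewrite /windmill_copy.
case: insubP => [u _ <-|/negPn/eqP j0];
  case: insubP => [u' _ <-|/negPn/eqP j0'] //=.
  by case=> ->.
by move=> _; apply: val_inj; rewrite j0 j0'.
Qed.

Lemma card_windmill_edge (m n : nat) (e : {set windmill_vertex m n}) :
  3 <= m -> e \in windmill_edges m n -> #|e| = 2.
Proof.
move=> m3 /imset2P[i e' _ e'C ->].
by rewrite card_imset ?(card_cycle_edge m3 e'C)//; exact: windmill_copy_inj.
Qed.

Record simplicial_complex (V : finType) := SimplicialComplex {
  faces : {set {set V}};
  faces_sub : forall s t : {set V},
    s \in faces -> t \subset s -> t \in faces }.

Definition matchings (T : finType) (E : {set {set T}}) : {set {set {set T}}} :=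
  [set H : {set {set T}} |
     (H \subset E) && [forall v, #|[set e in H | v \in e]| <= 1]].

Lemma matchings_sub (T : finType) (E : {set {set T}}) (H H' : {set {set T}}) :
  H \in matchings E -> H' \subset H -> H' \in matchings E.
Proof.
rewrite !inE => /andP[HE /forallP H1] H'H.
rewrite (subset_trans H'H HE); apply/forallP => v.
apply: leq_trans (H1 v); apply/subset_leq_card/subsetP => e.
by rewrite !inE => /andP[/(subsetP H'H)-> ->].
Qed.

(** The ambient vertex type is all of [{set T}], but a singleton [[set e]] is
    a face only if [e] is an edge. *)
Definition matching_complex (T : finType) (E : {set {set T}}) :
    simplicial_complex {set T} :=
  SimplicialComplex (@matchings_sub T E).

Definition supp (V : finType) (M : nmodType) (x : V -> M) : {set V} :=
  [set v | x v != 0%R].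

From mathcomp Require Import all_classical all_reals all_analysis.
From mathcomp Require Import homotopy.

Import numFieldNormedType.Exports.

Local Open Scope classical_set_scope.
Local Open Scope ring_scope.

(** Barycentric coordinates: a subspace of the finite-dimensional space
    [R ^ V], with the product topology. *)
Definition realization (R : realType) (V : finType)
    (K : simplicial_complex V) : topologicalType :=
  set_type [set x : {ptws V -> R} |
    [/\ forall v, 0 <= x v, \sum_v x v = 1 & supp x \in faces K]].

(** [H] only matters on [X * [0, 1]]. *)
Definition homotopic (R : realType) (X Y : topologicalType) (f g : X -> Y) :=
  exists H : X * R -> Y,
    [/\ {within [set xt | 0 <= xt.2 <= 1], continuous H},
        forall x, H (x, 0) = f x & forall x, H (x, 1) = g x].

Definition homotopy_equivalent (R : realType) (X Y : topologicalType) :=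
  exists (f : X -> Y) (g : Y -> X),
    [/\ continuous f, continuous g,
        homotopic R (g \o f) idfun & homotopic R (f \o g) idfun].

Definition one_point (R : realType) : topologicalType :=
  set_type [set 0 : R].

Definition unit_sphere (R : realType) (d : nat) : set 'rV[R]_d.+1 :=
  [set x : 'rV[R]_d.+1 | \sum_i x ord0 i ^+ 2 = 1].
Arguments unit_sphere R d _ : clear implicits.

Definition sphere (R : realType) (d : nat) : topologicalType :=
  set_type (unit_sphere R d).

Lemma sphere_base_subproof (R : realType) (d : nat) :
  delta_mx ord0 ord0 \in unit_sphere R d.
Proof.
apply/mem_set; rewrite /unit_sphere /= (bigD1 ord0) //= mxE !eqxx expr1n.
by rewrite big1 ?addr0// => i /negPf i0; rewrite mxE i0 andbF expr0n.
Qed.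

Definition sphere_base (R : realType) (d : nat) : sphere R d :=
  SigSub (sphere_base_subproof R d).

Definition wedge_of_spheres (R : realType) (r d : nat) : topologicalType :=
  wedge (fun _ : 'I_r => sphere_base R d).

(* Main.v *)
Require Import Defs.
From mathcomp Require Import all_boot all_order all_algebra.
From mathcomp Require Import all_classical all_reals all_analysis.
From mathcomp Require Import homotopy.
From mathcomp Require Import lra zify.

Set Implicit Arguments.
Unset Strict Implicit.
Unset Printing Implicit Defensive.

Import Order.TTheory GRing.Theory Num.Theory.
Import numFieldNormedType.Exports.

(** Write e_0, ..., e_(m-1) for the edges of a copy of the cycle, e_j joining
    the vertices j and j + 1.  A matching of the windmill is a set of edges no
    two of which conflict: within a copy, e_j conflicts with e_(j+1), and any
    two of the 2n central edges (e_0 and e_(m-1) of the copies) conflict.  So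
    the matching complex is the complex of conflict-free sets
    ([matching_equivalent]), and everything happens on such complexes.

    The combinatorial tool is one collapse ([collapse_equivalent]).  If every
    face containing s stays a face when the vertex a is added to it, then
    deleting all faces that contain s does not change the homotopy type: push
    the smallest barycentric coordinate found on s over to a.
    [collapse_family] iterates this.  Two patterns are used, both running
    through a path three edges at a time.

    - [fold_third_edges]: once e_0 no longer conflicts with e_1 (or is gone),
      e_1 conflicts with e_2 alone, so e_3 can be deleted with apex e_1; now
      e_4 conflicts with e_5 alone, so e_6 can be deleted with apex e_4; and so
      on.  What survives of the copy are the pairs of conflicting edges
      e_(3q+1), e_(3q+2), besides central edges.

    - The three unlinking lemmas reach the situation in which folding can
      start.  For m = 3k + 1 and m = 3k the link of a central edge is
      contractible, by a folding that ends in a cone, so that central edges can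
      be deleted: all the e_0 in the first case, with the folding inside the
      same copy ([unlink_1mod3]), and all the central edges in the second,
      with the folding inside another copy ([unlink_0mod3]).  For m = 3k + 2 it
      is the conflict between e_0 and e_1 that can be dropped, because the link
      of the set formed by e_0 and e_1, in the larger complex obtained by
      dropping it, is contractible ([unlink_2mod3]).

    After folding, m = 3k leaves a cone ([contractible_0mod3]).  For m = 3k + 1
    there remain nk pairs of conflicting edges with no other conflict, that is
    the boundary of the cross-polytope of dimension nk, homeomorphic to the
    sphere of dimension nk - 1 by central projection
    ([cross_polytope_sphere]).  For m = 3k + 2 there remain these nk pairs and
    the 2n central edges, which conflict with each other only: the join of the
    sphere of dimension nk - 1 with 2n points, that is 2n cones over this
    sphere.  Contracting one of the cones gives a wedge of 2n - 1 spheres of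
    dimension nk; [cross_join_wedge] writes down both maps and both homotopies
    in coordinates. *)

(** * Homotopy equivalences *)

Section Deformation.
Local Open Scope classical_set_scope.
Local Open Scope ring_scope.
Variable R : realType.

(** Homotopies continuous on the whole of X * R, which compose without any
    bookkeeping about subspaces; formulas that make sense on the unit interval
    alone are precomposed with [clamp] below. *)
Definition deforms (X Y : topologicalType) (f g : X -> Y) :=
  exists H : X * R -> Y,
    [/\ continuous H, forall x, H (x, 0) = f x & forall x, H (x, 1) = g x].

Definition equivalent (X Y : topologicalType) :=
  exists (f : X -> Y) (g : Y -> X),
    [/\ continuous f, continuous g,
        deforms (g \o f) idfun & deforms (f \o g) idfun].

Lemma equivalent_homotopy_equivalent (X Y : topologicalType) :
  equivalent X Y -> homotopy_equivalent R X Y.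
Proof.
move=> [f [g [cf cg [H [cH H0 H1]] [K [cK K0 K1]]]]].
exists f, g; split=> //; [exists H|exists K]; split=> //;
  exact: continuous_subspaceT.
Qed.

Lemma comp_continuous (X Y Z : topologicalType) (f : X -> Y) (g : Y -> Z) :
  continuous f -> continuous g -> continuous (g \o f).
Proof. by move=> cf cg x; apply: continuous_comp; [exact: cf|exact: cg]. Qed.

Lemma pair_continuous (X Y Z : topologicalType) (f : X -> Y) (g : X -> Z) :
  continuous f -> continuous g -> continuous (fun x => (f x, g x)).
Proof. by move=> cf cg x; apply: cvg_pair; [exact: cf|exact: cg]. Qed.

Lemma fst_continuous (X Y : topologicalType) : continuous (@fst X Y).
Proof. by move=> x; exact: cvg_fst. Qed.

Lemma snd_continuous (X Y : topologicalType) : continuous (@snd X Y).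
Proof. by move=> x; exact: cvg_snd. Qed.

Lemma deforms_refl (X Y : topologicalType) (f : X -> Y) :
  continuous f -> deforms f f.
Proof.
move=> cf; exists (f \o fst); split=> //.
exact: comp_continuous (@fst_continuous _ _) cf.
Qed.

Lemma deforms_comp (X Y Z W : topologicalType) (h : X -> Y) (f g : Y -> Z)
    (k : Z -> W) :
  continuous h -> continuous k -> deforms f g ->
  deforms (k \o f \o h) (k \o g \o h).
Proof.
move=> ch ck [H [cH H0 H1]].
exists (fun xt => k (H (h xt.1, xt.2))); split=> [|x|x] /=; last 2 first.
- by rewrite H0.
- by rewrite H1.
apply: (comp_continuous _ ck); apply: (comp_continuous _ cH).
apply: pair_continuous; last exact: snd_continuous.
exact: comp_continuous (@fst_continuous _ _) ch.
Qed.

Lemma deforms_trans (X Y : topologicalType) (f g h : X -> Y) :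
  deforms f g -> deforms g h -> deforms f h.
Proof.
move=> [H [cH H0 H1]] [K [cK K0 K1]].
pose P (xt : X * R) := if xt.2 <= 2^-1 then H (xt.1, 2 * xt.2)
                       else K (xt.1, 2 * xt.2 - 1).
have c2 : continuous (fun xt : X * R => 2 * xt.2 : R).
  by move=> xt; apply: cvgM; [exact: cvg_cst|exact: cvg_snd].
exists P; split=> [|x|x]; last 2 first.
- by rewrite /P /= invr_ge0 ler0n mulr0 H0.
- rewrite /P /= ifN ?mulr1; last by rewrite -ltNge; lra.
  by rewrite (_ : 2 - 1 = 1 :> R) ?K1//; lra.
apply/continuous_subspace_setT.
have -> : [set: X * R] =
    (snd @^-1` [set t | t <= 2^-1]) `|` (snd @^-1` [set t | t >= 2^-1]).
  by apply/seteqP; split=> // xt _ /=; apply/orP; exact: le_total.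
apply: withinU_continuous.
- by apply: preimage_closed => [xt _|]; [exact: snd_continuous|exact: closed_le].
- by apply: preimage_closed => [xt _|]; [exact: snd_continuous|exact: closed_ge].
- apply: (@subspace_eq_continuous (X * R)%type _ Y
    (fun xt : X * R => H (xt.1, 2 * xt.2))).
    by move=> [x t]; rewrite inE /from_subspace /P /= => ->.
  apply: continuous_subspaceT; apply: (comp_continuous _ cH).
  by apply: pair_continuous => //; exact: fst_continuous.
- apply: (@subspace_eq_continuous (X * R)%type _ Y
    (fun xt : X * R => K (xt.1, 2 * xt.2 - 1))).
    move=> [x t]; rewrite inE /from_subspace /P /= => t2; case: ifPn => // t2'.
    have -> : t = 2^-1 by apply: le_anti; rewrite t2 t2'.
    by rewrite mulfV ?subrr ?H1 ?K0// pnatr_eq0.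
  apply: continuous_subspaceT; apply: (comp_continuous _ cK).
  apply: pair_continuous; first exact: fst_continuous.
  by move=> xt; apply: cvgB; [exact: c2|exact: cvg_cst].
Qed.

Lemma equivalent_sym (X Y : topologicalType) : equivalent X Y -> equivalent Y X.
Proof. by move=> [f [g [cf cg H K]]]; exists g, f. Qed.

Lemma equivalent_trans (X Y Z : topologicalType) :
  equivalent X Y -> equivalent Y Z -> equivalent X Z.
Proof.
move=> [f [g [cf cg gf fg]]] [h [k [ch ck kh hk]]].
exists (h \o f), (g \o k); split.
- exact: comp_continuous.
- exact: comp_continuous.
- exact: deforms_trans (deforms_comp cf cg kh) gf.
- exact: deforms_trans (deforms_comp ck ch fg) hk.
Qed.

Lemma homeomorphic_equivalent (X Y : topologicalType) (f : X -> Y) (g : Y -> X) :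
  continuous f -> continuous g -> cancel f g -> cancel g f -> equivalent X Y.
Proof.
move=> cf cg fK gK; exists f, g; split=> //.
- rewrite (_ : g \o f = idfun); last exact/funext/fK.
  by apply: deforms_refl => x; exact: cvg_id.
- rewrite (_ : f \o g = idfun); last exact/funext/gK.
  by apply: deforms_refl => x; exact: cvg_id.
Qed.

Definition clamp (t : R) : R := Num.max 0 (Num.min 1 t).

Lemma clamp0 : clamp 0 = 0.
Proof. by rewrite /clamp min_r ?maxxx ?ler01. Qed.

Lemma clamp1 : clamp 1 = 1.
Proof. by rewrite /clamp minxx max_r ?ler01. Qed.

Lemma clamp_itv t : 0 <= clamp t <= 1.
Proof. by rewrite /clamp le_max lexx ge_max ler01 ge_min lexx. Qed.

(** * Continuous maps given by coordinates *)

Section RealValued.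
Variable X : topologicalType.
Implicit Types f g : X -> R.

Lemma addr_continuous f g :
  continuous f -> continuous g -> continuous (fun x => f x + g x).
Proof. by move=> cf cg x; apply: cvgD; [exact: cf|exact: cg]. Qed.

Lemma subr_continuous f g :
  continuous f -> continuous g -> continuous (fun x => f x - g x).
Proof. by move=> cf cg x; apply: cvgB; [exact: cf|exact: cg]. Qed.

Lemma mulr_continuous f g :
  continuous f -> continuous g -> continuous (fun x => f x * g x).
Proof. by move=> cf cg x; apply: cvgM; [exact: cf|exact: cg]. Qed.

Lemma cstr_continuous (a : R) : continuous (fun _ : X => a).
Proof. by move=> x; exact: cvg_cst. Qed.

Lemma divr_continuous f g : (forall x, g x != 0) ->
  continuous f -> continuous g -> continuous (fun x => f x / g x).
Proof.
move=> g0 cf cg x; apply: cvgM; first exact: cf.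
by apply: cvgV; [exact: g0|exact: cg].
Qed.

Lemma sqrtr_continuous f :
  continuous f -> continuous (fun x => Num.sqrt (f x)).
Proof. by move=> cf; exact: comp_continuous cf (@sqrt_continuous R). Qed.

Lemma maxr_continuous f g :
  continuous f -> continuous g -> continuous (fun x => Num.max (f x) (g x)).
Proof.
by move=> cf cg x; apply: (@continuous_max R X f g x); [exact: cf|exact: cg].
Qed.

Lemma minr_continuous f g :
  continuous f -> continuous g -> continuous (fun x => Num.min (f x) (g x)).
Proof.
by move=> cf cg x; apply: (@continuous_min R X f g x); [exact: cf|exact: cg].
Qed.

Lemma sumr_continuous (I : Type) (r : seq I) (P : pred I) (f : I -> X -> R) :
  (forall i, P i -> continuous (f i)) ->
  continuous (fun x => \sum_(i <- r | P i) f i x).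
Proof.
move=> cf; elim: r => [|i r IH].
  by under eq_fun do rewrite big_nil; exact: cstr_continuous.
case: (boolP (P i)) => [Pi|/negPf Pi]; under eq_fun do rewrite big_cons Pi;
  last exact: IH.
by apply: addr_continuous => //; exact: cf.
Qed.

Lemma minr_big_continuous (I : Type) (r : seq I) (P : pred I) (a : R)
    (f : I -> X -> R) :
  (forall i, P i -> continuous (f i)) ->
  continuous (fun x => \big[Num.min/a]_(i <- r | P i) f i x).
Proof.
move=> cf; elim: r => [|i r IH].
  by under eq_fun do rewrite big_nil; exact: cstr_continuous.
case: (boolP (P i)) => [Pi|/negPf Pi]; under eq_fun do rewrite big_cons Pi;
  last exact: IH.
by apply: minr_continuous => //; exact: cf.
Qed.

Lemma clamp_continuous f : continuous f -> continuous (fun x => clamp (f x)).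
Proof.
move=> cf; apply: maxr_continuous; first exact: cstr_continuous.
by apply: minr_continuous => //; exact: cstr_continuous.
Qed.

End RealValued.

Section Coordinates.

Lemma initial_into_continuous (X Z : topologicalType) (A : set Z)
    (f : X -> A) :
  continuous (fun x => set_val (f x)) -> continuous f.
Proof. exact: (@continuous_comp_initial A X Z set_val). Qed.

Lemma ptws_into_continuous (X : topologicalType) (V : finType)
    (f : X -> {ptws V -> R}) :
  (forall v, continuous (fun x => f x v : R)) -> continuous f.
Proof.
move=> cf x; apply/cvg_sup => v.
apply: (@continuous_comp_initial {ptws V -> R} X R (fun g => g v) f).
exact: cf.
Qed.

Lemma row_into_continuous (X : topologicalType) (d : nat) (f : X -> 'rV[R]_d) :
  (forall i, continuous (fun x => f x ord0 i)) -> continuous f.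
Proof.
move=> cf x U [P Pf PU].
have : \forall y \near x, forall i : 'I_d, P ord0 i (f y ord0 i).
  by apply: filter_forall => i; apply: cf; exact: Pf.
apply: filterS => y Py; apply: PU => i j; rewrite ord1; exact: Py.
Qed.

End Coordinates.

Section Realization.
Variables (V : finType) (K : simplicial_complex V).

Definition bary (x : realization R K) : V -> R := set_val x.

Lemma realizationP (x : realization R K) :
  [/\ forall v, 0 <= bary x v, \sum_v bary x v = 1
    & supp (bary x) \in faces K].
Proof. exact: (set_mem (valP x)). Qed.

Lemma realization_inj (x y : realization R K) :
  (forall v, bary x v = bary y v) -> x = y.
Proof. by move=> xy; apply: val_inj; apply/funext. Qed.

Lemma bary_continuous v :
  continuous (fun x => bary x v).
Proof.
move=> x; apply: (@continuous_comp _ {ptws V -> R} _ set_val (fun g => g v)).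
  exact: initial_continuous.
exact: (@proj_continuous V (fun _ => R) v).
Qed.

(** Maps into a realization are written down without caring about the sum of the
    coordinates: dividing by it does not change the support. *)
Lemma into_realization (X : topologicalType) (F : X -> V -> R) :
  (forall v, continuous (F^~ v)) -> (forall x v, 0 <= F x v) ->
  (forall x, supp (F x) \in faces K) -> (forall x, exists v, F x v != 0) ->
  exists2 f : X -> realization R K, continuous f &
    forall x v, bary (f x) v = F x v / \sum_u F x u.
Proof.
move=> cF F0 FK Fn0.
have sF0 x : 0 < \sum_u F x u.
  have [v v0] := Fn0 x; rewrite (bigD1 v) //=.
  by rewrite ltr_pwDl ?lt0r ?v0 ?F0// sumr_ge0.
have fP x : ((fun v => F x v / \sum_u F x u) : {ptws V -> R}) \in
    [set x : {ptws V -> R} |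
    [/\ forall v, 0 <= x v, \sum_v x v = 1 & supp x \in faces K]].
  apply/mem_set; split=> [v||].
  - by rewrite divr_ge0 ?F0// ltW.
  - by rewrite -mulr_suml mulfV// gt_eqF.
  - rewrite (_ : supp _ = supp (F x))//; apply/setP => v.
    by rewrite !inE mulf_eq0 invr_eq0 negb_or (gt_eqF (sF0 x)) andbT.
exists (fun x => SigSub (fP x)) => //.
apply: initial_into_continuous; apply: ptws_into_continuous => v.
apply: divr_continuous => //; first by move=> x; rewrite gt_eqF.
exact: sumr_continuous.
Qed.

End Realization.

End Deformation.

(** * Collapses of simplicial complexes *)

Section Collapse.
Local Open Scope classical_set_scope.
Local Open Scope ring_scope.
Variables (R : realType) (V : finType).
Implicit Types (K : simplicial_complex V) (s t : {set V}) (a : V).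

Lemma bary_ge0 K (x : realization R K) v : 0 <= bary x v.
Proof. by have [x0 _ _] := realizationP x. Qed.

Lemma bary_le1 K (x : realization R K) v : bary x v <= 1.
Proof.
have [x0 <- _] := realizationP x.
by rewrite (bigD1 v) //= lerDl sumr_ge0.
Qed.

Lemma sum1_neq0 (F : V -> R) : \sum_v F v = 1 -> exists v, F v != 0.
Proof.
move=> F1; apply/existsP; apply: contra_eqT F1.
rewrite negb_exists => /forallP F0.
rewrite big1 1?eq_sym ?oner_neq0// => v _.
by apply/eqP; rewrite -[_ == _]negbK.
Qed.

Lemma bary_neq0 K (x : realization R K) : exists v, bary x v != 0.
Proof. by have [_ x1 _] := realizationP x; exact: sum1_neq0. Qed.

Lemma into_realization1 K (X : topologicalType) (F : X -> V -> R) :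
  (forall v, continuous (F^~ v)) -> (forall x v, 0 <= F x v) ->
  (forall x, supp (F x) \in faces K) -> (forall x, \sum_v F x v = 1) ->
  exists2 f : X -> realization R K, continuous f &
    forall x v, bary (f x) v = F x v.
Proof.
move=> cF F0 FK F1.
have [x|f cf fE] := into_realization cF F0 FK; first exact: sum1_neq0.
by exists f => // x v; rewrite fE F1 divr1.
Qed.

Lemma inclusion_realization K K' : {subset faces K' <= faces K} ->
  exists2 f : realization R K' -> realization R K, continuous f &
    forall x v, bary (f x) v = bary x v.
Proof.
move=> sK; apply: (into_realization1 (F := fun x v => bary x v)).
- exact: bary_continuous.
- exact: bary_ge0.
- by move=> x; apply: sK; have [] := realizationP x.
- by move=> x; have [] := realizationP x.
Qed.

(** Let h x be the smallest coordinate of x on s.  Subtracting c * h x from the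
    coordinates on s and adding it at a stays, up to a factor, in the
    realization: if h x is nonzero then s lies in the support, and a may be added
    to it.  At c = 1 some
    coordinate on s has become 0, hence a deformation retraction. *)
Lemma collapse_equivalent K K' s a :
  (forall t, (t \in faces K') = (t \in faces K) && ~~ (s \subset t)) ->
  s != finset.set0 -> a \notin s ->
  (forall t, t \in faces K -> s \subset t -> a |: t \in faces K) ->
  equivalent R (realization R K) (realization R K').
Proof.
move=> K'E /set0Pn[s0 s0s] aNs aK.
pose h (x : realization R K) : R := \big[Num.min/1]_(w in s) bary x w.
have h_ge0 x : 0 <= h x.
  by rewrite /h; elim/big_rec: _ => // i u _ u0; rewrite le_min bary_ge0.
have h_le x w : w \in s -> h x <= bary x w by exact: bigmin_le_cond.
have hE x : exists2 w, w \in s & h x = bary x w.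
  have [|w ws hw] := @Order.TotalTheory.eq_bigmin _ _ _ 1 s0 (mem s)
    (fun w => bary x w) s0s.
    by move=> w _; exact: bary_le1.
  by exists w.
have ch : continuous h.
  by apply: minr_big_continuous => w _; exact: bary_continuous.
pose F x c v : R := bary x v - c * h x * (v \in s)%:R + c * h x * (v == a)%:R.
have F0 x v : F x 0 v = bary x v.
  by rewrite /F !mul0r subr0 addr0.
have Fh0 x c v : h x = 0 -> F x c v = bary x v.
  by rewrite /F => ->; rewrite mulr0 !mul0r subr0 addr0.
have F_ge0 x (c : R) v : 0 <= c <= 1 -> 0 <= F x c v.
  move=> /andP[c0 c1]; rewrite /F addr_ge0//; last first.
    by rewrite mulr_ge0 ?mulr_ge0// ler0n.
  rewrite subr_ge0; case: (boolP (v \in s)) => vs; rewrite ?mulr1 ?mulr0.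
    by apply: le_trans (h_le x v vs); rewrite ler_piMl.
  exact: bary_ge0.
have F_neq0 x (c : R) : 0 <= c <= 1 -> exists v, F x c v != 0.
  have [v v0] := bary_neq0 x => c01.
  have [hx|/eqP hx] := eqVneq (c * h x) 0.
    by exists v; rewrite /F hx !mul0r subr0 addr0.
  exists a; rewrite /F (negPf aNs) eqxx mulr0 mulr1 subr0 gt_eqF//.
  rewrite ltr_wpDl ?bary_ge0// lt0r; apply/andP; split; first exact/eqP.
  by case/andP: c01 => c0 _; rewrite mulr_ge0.
have FK x c : supp (F x c) \in faces K.
  have [_ _ xK] := realizationP x.
  have [hx|hx] := eqVneq (h x) 0.
    rewrite (_ : supp _ = supp (bary x))//; apply/setP => v.
    by rewrite !inE Fh0.
  have sx : s \subset supp (bary x).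
    apply/fintype.subsetP => w ws; rewrite inE; apply: contraNneq hx => xw.
    by rewrite eq_le h_ge0 andbT -xw h_le.
  apply: faces_sub (aK _ xK sx) _; apply/fintype.subsetP => v.
  rewrite !inE; case: (eqVneq v a) => //= va; apply: contra_neq => xv.
  have vs : v \notin s.
    by apply/negP => /(fintype.subsetP sx); rewrite inE xv eqxx.
  by rewrite /F (negPf va) (negPf vs) !mulr0 xv subr0 addr0.
have FK' x : supp (F x 1) \in faces K'.
  rewrite K'E FK /=; have [w ws hw] := hE x.
  apply/fintype.subsetPn; exists w => //; rewrite inE negbK /F ws.
  have /negPf-> : w != a by apply: contraNneq aNs => <-.
  by rewrite !mul1r mulr1 mulr0 addr0 hw subrr.
have cF c v : continuous (fun x => F x c v).
  apply: addr_continuous; first apply: subr_continuous;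
    try exact: bary_continuous;
    do 2?apply: mulr_continuous => //; exact: cstr_continuous.
have i01 : 0 <= (1 : R) <= 1 by rewrite lexx ler01.
have [v|x v|||r cr rE] := @into_realization R V K' _ (fun x => F x 1).
- exact: cF.
- exact: F_ge0.
- exact: FK'.
- by move=> x; exact: F_neq0.
have [|i ci iE] := @inclusion_realization K K'.
  by move=> t; rewrite K'E => /andP[].
exists r, i; split=> //.
(* [H] runs from the retraction at time 0 to the identity at time 1. *)
- pose G (xt : realization R K * R) v := F xt.1 (1 - clamp xt.2) v.
  have c01 (u : R) : 0 <= 1 - clamp u <= 1.
    by have /andP[] := clamp_itv u => c0 c1; apply/andP; split; lra.
  have cfst v : continuous (fun xt : realization R K * R => bary xt.1 v).
    exact: comp_continuous (@fst_continuous _ _) (@bary_continuous _ _ _ v).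
  have csnd : continuous (fun xt : realization R K * R => 1 - clamp xt.2).
    apply: subr_continuous; first exact: cstr_continuous.
    by apply: clamp_continuous; exact: snd_continuous.
  have cfh : continuous (fun xt : realization R K * R => h xt.1).
    exact: comp_continuous (@fst_continuous _ _) ch.
  have [v|xt v|xt|xt|H cH HE] := @into_realization R V K _ G.
  + apply: addr_continuous; first apply: subr_continuous => //;
      do 2?apply: mulr_continuous => //; exact: cstr_continuous.
  + exact: F_ge0.
  + exact: FK.
  + exact: F_neq0.
  exists H; split=> // x; apply: realization_inj => v; rewrite HE /G /=.
    by rewrite iE rE clamp0 subr0.
  rewrite clamp1 subrr F0; under eq_bigr do rewrite F0.
  by have [_ -> _] := realizationP x; rewrite divr1.
- rewrite (_ : r \o i = idfun).
    by apply: deforms_refl => x; exact: cvg_id.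
  apply/funext => x; apply: realization_inj => v /=.
  have h0 : h (i x) = 0.
    have [_ _ xK] := realizationP x; move: xK; rewrite K'E => /andP[_].
    case/fintype.subsetPn => w ws; rewrite inE negbK => /eqP xw.
    by apply/eqP; rewrite eq_le h_ge0 andbT -xw -iE h_le.
  rewrite rE Fh0// iE; under eq_bigr do rewrite Fh0// iE.
  by have [_ -> _] := realizationP x; rewrite divr1.
Qed.
End Collapse.

Section Simplicial.
Local Open Scope classical_set_scope.
Local Open Scope ring_scope.
Variable R : realType.

Lemma simplicial_complex_eq (V : finType) (K K' : simplicial_complex V) :
  faces K =i faces K' -> K = K'.
Proof.
case: K K' => [F sF] [F' sF'] /= /setP FF'; subst F'.
by congr SimplicialComplex; exact: Prop_irrelevance.
Qed.

Section Avoid.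
Variables (V I : finType) (K : simplicial_complex V) (s : I -> {set V}).
Variable A : {set I}.

Definition avoid_faces : {set {set V}} :=
  [set t in faces K | [forall i in A, ~~ (s i \subset t)]]%SET.

Lemma avoid_faces_sub (t u : {set V}) :
  t \in avoid_faces -> u \subset t -> u \in avoid_faces.
Proof.
rewrite !inE => /andP[tK /forall_inP tA] ut; rewrite (faces_sub tK ut) /=.
apply/forall_inP => i iA; apply: contra (tA i iA) => siu.
exact: fintype.subset_trans ut.
Qed.

Definition avoid := SimplicialComplex avoid_faces_sub.

Lemma avoidE t :
  (t \in faces avoid) = (t \in faces K) && [forall i in A, ~~ (s i \subset t)].
Proof. by rewrite inE. Qed.

End Avoid.

Definition avoid_all (V I : finType) (K : simplicial_complex V)
    (s : I -> {set V}) := avoid K s [set: I]%SET.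

Lemma avoid_allP (V I : finType) (K : simplicial_complex V) (s : I -> {set V})
    t :
  reflect (t \in faces K /\ forall i, ~~ (s i \subset t))
          (t \in faces (avoid_all K s)).
Proof.
rewrite avoidE; apply: (iffP andP) => -[tK].
  by move=> /forall_inP tA; split=> // i; apply: tA; rewrite inE.
by move=> tA; split=> //; apply/forall_inP.
Qed.

(** The faces containing some [s i] are deleted in the order of increasing rank:
    when [s i] is treated, the sets of smaller rank are already excluded.  Since
    no apex belongs to any [s j], adding an apex cannot reintroduce a deleted
    face. *)
Lemma collapse_family (V I : finType) (K : simplicial_complex V)
    (s : I -> {set V}) (a : I -> V) (rk : I -> nat) :
  (forall i, s i != finset.set0) -> (forall i j, a i \notin s j) ->
  (forall i t, t \in faces K -> s i \subset t ->
     (forall j, (rk j < rk i)%N -> ~~ (s j \subset t)) ->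
     a i |: t \in faces K) ->
  equivalent R (realization R K) (realization R (avoid_all K s)).
Proof.
move=> s0 aNs aK.
(* [A] is the set of indices already treated; it grows by an index of least rank. *)
suff H n (A : {set I}) : (#|~: A| <= n)%N ->
    (forall i j, i \in A -> (rk j < rk i)%N -> j \in A) ->
    equivalent R (realization R (avoid K s A))
                 (realization R (avoid K s [set: I])).
  rewrite {1}(_ : K = avoid K s finset.set0).
    by apply: (H _ _ (leqnn _)) => i j; rewrite inE.
  apply: simplicial_complex_eq => t; rewrite avoidE.
  rewrite (_ : [forall i in _, _] = true) ?andbT//.
  by apply/forall_inP => i; rewrite inE.
have refl (B : simplicial_complex V) :
    equivalent R (realization R B) (realization R B).
  by apply: (@homeomorphic_equivalent _ _ _ idfun idfun) => // x; exact: cvg_id.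
elim: n A => [|n IH] A An dA.
  have -> : A = [set: I]%SET; last exact: refl.
  by apply/setP => i; move: An; rewrite leqn0 cards_eq0 => /eqP/setP/(_ i);
    rewrite !inE => /negbFE.
have [->|] := eqVneq A [set: I]%SET; first exact: refl.
rewrite -finset.subTset => /fintype.subsetPn[i0 _ i0A].
case: (@arg_minnP _ i0 (fun j => j \notin A) rk i0A) => i iA imin.
apply: equivalent_trans (IH (i |: A)%SET _ _); last 2 first.
- rewrite -ltnS; apply: leq_trans An; apply: proper_card.
  apply/properP; split; last by exists i; rewrite !inE ?eqxx ?iA.
  by apply/fintype.subsetP => j; rewrite !inE negb_or => /andP[].
- move=> j k; rewrite !inE => /predU1P[->|jA] kj.
    apply/orP; right; apply/negPn/negP => kA.
    by have := imin k kA; rewrite leqNgt kj.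
  by rewrite (dA j) ?orbT.
apply: (@collapse_equivalent _ _ _ _ (s i) (a i)) => //.
- move=> t; rewrite !avoidE -andbA; congr andb.
  apply/forall_inP/andP => [tA|[/forall_inP tA ti] j].
    split; last by apply: tA; rewrite !inE eqxx.
    by apply/forall_inP => j jA; apply: tA; rewrite !inE jA orbT.
  by rewrite !inE => /predU1P[->|/tA].
- move=> t; rewrite !avoidE => /andP[tK /forall_inP tA] st; apply/andP; split.
    apply: (aK i) => // j ji; apply: tA; apply/negPn/negP => jA.
    by have := imin j jA; rewrite leqNgt ji.
  apply/forall_inP => j jA; apply: contra (tA j jA) => /fintype.subsetP sj.
  apply/fintype.subsetP => v vs; have := sj v vs; rewrite !inE.
  by case/predU1P => // va; move: (aNs i j); rewrite -va vs.
Qed.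

(** A point of the first realization has no coordinate outside the image of e, so
    restricting its coordinates along e loses nothing. *)
Lemma vertex_map_equivalent (V W : finType) (e : W -> V)
    (K : simplicial_complex V) (L : simplicial_complex W) :
  injective e -> (forall t v, t \in faces K -> v \in t -> exists w, v = e w) ->
  (forall A : {set W}, (A \in faces L) = (e @: A \in faces K)) ->
  equivalent R (realization R K) (realization R L).
Proof.
move=> einj eK eL.
have x0 (x : realization R K) v : (forall w, v != e w) -> bary x v = 0.
  move=> vNe; apply/eqP/negPn/negP => xv; have [_ _ xK] := realizationP x.
  have [|w vw] := eK _ v xK; first by rewrite inE.
  by move: (vNe w); rewrite vw eqxx.
have sumE (x : realization R K) : \sum_w bary x (e w) = 1.
  have [_ <- _] := realizationP x.
  rewrite [RHS](bigID (mem [set e w | w in W]%SET)) /= [X in _ + X]big1 ?addr0.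
    by rewrite big_imset//= => w w' _ _; exact: einj.
  by move=> v /imsetP vNe; apply: x0 => w; apply/eqP => vw; apply: vNe; exists w.
pose G (y : realization R L) v : R := \sum_(w | e w == v) bary y w.
have [w|x w|x|//|f cf fE] :=
  @into_realization1 R W L (realization R K) (fun x w => bary x (e w)).
- exact: bary_continuous.
- exact: bary_ge0.
- have [_ _ xK] := realizationP x; rewrite eL; apply: faces_sub xK _.
  by apply/fintype.subsetP => _ /imsetP[w + ->]; rewrite !inE.
have [v|y v|y|y|g cg gE] := @into_realization1 R V K (realization R L) G.
- by apply: sumr_continuous => w _; exact: bary_continuous.
- by apply: sumr_ge0 => w _; exact: bary_ge0.
- have [_ _] := realizationP y; rewrite eL => /faces_sub; apply.
  apply/fintype.subsetP => v; rewrite inE; apply: contraR => vNy.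
  apply/eqP; rewrite /G big1// => w /eqP wv; apply/eqP/negPn/negP => yw.
  by move/imsetP: vNy; apply; exists w; rewrite // inE.
- have [_ <- _] := realizationP y; rewrite [RHS](partition_big e xpredT) //.
apply: (@homeomorphic_equivalent _ _ _ f g) => // x; apply: realization_inj => v.
  rewrite gE /G; have [[w ->]|nv] := pselect (exists w, v = e w).
    by rewrite (big_pred1 w) ?fE// => w'; rewrite inj_eq.
  rewrite big_pred0 ?x0// => w; apply/eqP => wv; apply: nv; exists w => //.
by rewrite fE gE /G (big_pred1 v)// => w; rewrite inj_eq.
Qed.

Lemma cone_contractible (V : finType) (K : simplicial_complex V) (a : V) :
  finset.set0 \in faces K -> (forall t, t \in faces K -> a |: t \in faces K) ->
  equivalent R (realization R K) (one_point R).
Proof.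
move=> K0 aK.
have aK1 : [set a]%SET \in faces K by rewrite -(finset.setU0 [set a]%SET) aK.
have [v|_ v|_|_|p cp pE] := @into_realization1 R V K (one_point R)
  (fun _ v => (v == a)%:R).
- exact: cstr_continuous.
- exact: ler0n.
- apply: faces_sub aK1 _; apply/fintype.subsetP => v; rewrite !inE.
  by case: (v == a) => //; rewrite eqxx.
- by rewrite (bigD1 a) //= eqxx big1 ?addr0// => v /negPf ->.
have o0 : 0 \in ([set 0 : R] : set R) by apply/mem_set.
pose o : one_point R := SigSub o0.
have oE (x : one_point R) : x = o.
  by apply: val_inj; case: x => x /= /set_mem ->.
exists (fun=> o), p; split=> //.
- by apply: initial_into_continuous; exact: cstr_continuous.
- pose F (xt : realization R K * R) v : R :=
    clamp xt.2 * bary xt.1 v + (1 - clamp xt.2) * (v == a)%:R.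
  have cF v : continuous (F^~ v).
    have cc : continuous (fun xt : realization R K * R => clamp xt.2).
      by apply: clamp_continuous; exact: snd_continuous.
    apply: addr_continuous; apply: mulr_continuous => //.
    + exact: comp_continuous (@fst_continuous _ _) (@bary_continuous _ _ _ v).
    + by apply: subr_continuous => //; exact: cstr_continuous.
    + exact: cstr_continuous.
  have [xt v|xt|xt|H cH HE] := @into_realization1 R V K _ F cF.
  + have /andP[c0 c1] := clamp_itv xt.2.
    by rewrite addr_ge0// mulr_ge0 ?bary_ge0 ?ler0n ?subr_ge0.
  + have [_ _ xK] := realizationP xt.1; apply: faces_sub (aK _ xK) _.
    apply/fintype.subsetP => v; rewrite !inE; case: (eqVneq v a) => //= va.
    apply: contra_neq => xv.
    by rewrite /F xv (negPf va) !mulr0 addr0.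
  + rewrite big_split /= -!mulr_sumr; have [_ -> _] := realizationP xt.1.
    rewrite (bigD1 a) //= eqxx big1 ?addr0 ?mulr1 1?addrC ?subrK//.
    by move=> v /negPf ->.
  exists H; split=> // x; apply: realization_inj => v; rewrite HE /F /=.
    by rewrite pE clamp0 mul0r add0r subr0 mul1r.
  by rewrite clamp1 subrr mul0r mul1r addr0.
- rewrite (_ : _ \o _ = idfun); last by apply/funext => x; rewrite [RHS]oE.
  by apply: deforms_refl => x; exact: cvg_id.
Qed.

End Simplicial.

(** * Spheres and cross-polytopes *)

Section Spheres.
Local Open Scope classical_set_scope.
Local Open Scope ring_scope.
Variable R : realType.

Definition normalize1 (V : finType) (F : V -> R) (v : V) : R := F v / \sum_u F u.

Definition normalize2 (d : nat) (F : 'I_d -> R) (i : 'I_d) : R :=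
  F i / Num.sqrt (\sum_j F j ^+ 2).

Lemma normalize1_scale (V : finType) (c : R) (F G : V -> R) :
  0 < c -> (forall v, F v = c * G v) -> normalize1 F = normalize1 G.
Proof.
move=> c0 FG; apply/funext => v; rewrite /normalize1 FG.
under eq_bigr do rewrite FG.
by rewrite -mulr_sumr invfM mulrACA mulfV ?mul1r// gt_eqF.
Qed.

Lemma normalize2_scale (d : nat) (c : R) (F G : 'I_d -> R) :
  0 < c -> (forall i, F i = c * G i) -> normalize2 F = normalize2 G.
Proof.
move=> c0 FG; apply/funext => v; rewrite /normalize2 FG.
under eq_bigr do rewrite FG exprMn.
rewrite -mulr_sumr sqrtrM ?sqr_ge0// sqrtr_sqr gtr0_norm//.
by rewrite invfM mulrACA mulfV ?mul1r// gt_eqF.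
Qed.

Lemma sum_sqr_gt0 (d : nat) (F : 'I_d -> R) :
  (exists i, F i != 0) -> 0 < \sum_i F i ^+ 2.
Proof.
move=> [i Fi]; rewrite (bigD1 i) //= ltr_pwDl ?exprn_even_gt0//.
by rewrite sumr_ge0// => j _; exact: sqr_ge0.
Qed.

Section SphereCoordinates.
Variable d : nat.

Definition cart (z : sphere R d) (i : 'I_d.+1) : R :=
  (set_val z : 'rV[R]_d.+1) ord0 i.

Lemma cart_sum z : \sum_i cart z i ^+ 2 = 1.
Proof. exact: (set_mem (valP z)). Qed.

Lemma cart_neq0 z : exists i, cart z i != 0.
Proof.
apply/existsP; apply: contra_eqT (cart_sum z).
rewrite negb_exists => /forallP z0.
rewrite big1 1?eq_sym ?oner_neq0// => i _.
by move: (z0 i); rewrite negbK => /eqP ->; rewrite expr0n.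
Qed.

Lemma sphere_inj (z w : sphere R d) : (forall i, cart z i = cart w i) -> z = w.
Proof. by move=> zw; apply: val_inj; apply/rowP => i; exact: zw. Qed.

Lemma cart_continuous i : continuous (fun z => cart z i).
Proof.
move=> z; apply: (@continuous_comp _ 'rV[R]_d.+1 _ set_val (fun M => M ord0 i)).
  exact: initial_continuous.
exact: coord_continuous.
Qed.

Lemma normalize2_cart z : normalize2 (cart z) = cart z.
Proof.
by apply/funext => i; rewrite /normalize2 cart_sum sqrtr1 divr1.
Qed.

Lemma cart_base i : cart (sphere_base R d) i = (i == ord0)%:R.
Proof. by rewrite /cart /= set_valE /= mxE eqxx. Qed.

Lemma cart_base_eq z : cart z ord0 = 1 -> z = sphere_base R d.
Proof.
move=> z0; have := cart_sum z.
rewrite (bigD1 ord0) //= z0 expr1n => /eqP; rewrite eq_sym addrC -subr_eq subrr.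
rewrite eq_sym psumr_eq0 => [/allP zi|i _]; last exact: sqr_ge0.
apply: sphere_inj => i; rewrite cart_base; have [->//|i0] := eqVneq i ord0.
have := zi i (mem_index_enum _).
by rewrite i0 /= expf_eq0 => /andP[_ /eqP].
Qed.

Lemma into_sphere (X : topologicalType) (F : X -> 'I_d.+1 -> R) :
  (forall i, continuous (F^~ i)) -> (forall x, exists i, F x i != 0) ->
  exists2 f : X -> sphere R d, continuous f &
    forall x, cart (f x) = normalize2 (F x).
Proof.
move=> cF F0.
have s0 x : 0 < Num.sqrt (\sum_j F x j ^+ 2).
  by rewrite sqrtr_gt0 sum_sqr_gt0.
have fP x : (\row_i normalize2 (F x) i) \in unit_sphere R d.
  apply/mem_set; rewrite /unit_sphere /=.
  under eq_bigr do rewrite mxE /normalize2 expr_div_n.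
  rewrite -mulr_suml sqr_sqrtr ?mulfV// ?gt_eqF ?sum_sqr_gt0//.
  by rewrite ltW// sum_sqr_gt0.
exists (fun x => SigSub (fP x)); last first.
  by move=> x; apply/funext => i; rewrite /cart /= set_valE /= mxE.
apply: initial_into_continuous; apply: row_into_continuous => i.
rewrite (_ : (fun x => _) = fun x => normalize2 (F x) i); last first.
  by apply/funext => x; rewrite set_valE /= mxE.
apply: divr_continuous => // [x|]; first by rewrite gt_eqF.
apply: sqrtr_continuous; apply: sumr_continuous => j _.
by under eq_fun do rewrite expr2; exact: mulr_continuous.
Qed.

End SphereCoordinates.

Definition pos (a : R) : R := Num.max 0 a.

Lemma pos_ge0 a : 0 <= pos a.
Proof. by rewrite le_max lexx. Qed.

Lemma pos_scale c a : 0 <= c -> pos (c * a) = c * pos a.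
Proof. by move=> c0; rewrite /pos maxr_pMr// mulr0. Qed.

Lemma pos_subN a : pos a - pos (- a) = a.
Proof. by rewrite /pos; case: (leP 0 a) => a0; rewrite !maxEle; do 2?case: ifP; lra. Qed.

Lemma pos_diff a b : 0 <= a -> 0 <= b -> a * b = 0 -> pos (a - b) = a.
Proof.
move=> a0 b0 /eqP; rewrite mulf_eq0 => /orP[]/eqP e; subst.
  by rewrite /pos sub0r max_l// oppr_le0.
by rewrite subr0 /pos max_r.
Qed.

Lemma pos_eq0 a : a <= 0 -> pos a = 0.
Proof. by move=> a0; rewrite /pos max_l. Qed.

Lemma pos_continuous (X : topologicalType) (f : X -> R) :
  continuous f -> continuous (fun x => pos (f x)).
Proof. by move=> cf; apply: maxr_continuous => //; exact: cstr_continuous. Qed.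

Definition sgn (c : bool) (a : R) : R := if c then a else - a.

Lemma sgn_continuous (X : topologicalType) c (f : X -> R) :
  continuous f -> continuous (fun x => sgn c (f x)).
Proof.
move=> cf; case: c => //=.
by move=> x; apply: cvgN; exact: cf.
Qed.

(** The boundary of the cross-polytope: vertex (i, true) is the i-th basis vector
    and (i, false) its opposite.  The coordinates of the i-th axis have product 0
    on a face, so they are recovered as the positive parts of their difference
    and of its opposite; central projection does the rest. *)
Section CrossPolytope.
Variables (d : nat) (K : simplicial_complex ('I_d.+1 * bool)%type).
Hypothesis KE : forall A, (A \in faces K) =
  [forall i, ~~ (((i, true) \in A) && ((i, false) \in A))].

Lemma cross_polytope_sphere :
  equivalent R (realization R K) (sphere R d).
Proof.
have opp (x : realization R K) i : bary x (i, true) * bary x (i, false) = 0.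
  have [_ _] := realizationP x; rewrite KE => /forallP/(_ i).
  by rewrite !inE negb_and !negbK => x0; apply/eqP; rewrite mulf_eq0.
pose F (x : realization R K) i := bary x (i, true) - bary x (i, false).
have posF x v : pos (sgn v.2 (F x v.1)) = bary x v.
  case: v => i [] /=; rewrite /F ?opprB pos_diff ?bary_ge0//.
  by rewrite mulrC.
have [i|x|f cf fE] := @into_sphere d (realization R K) F.
- by apply: subr_continuous; exact: bary_continuous.
- have [[i c] xic] := bary_neq0 x; exists i; apply: contraNneq xic => F0.
  by rewrite -posF /= F0 /sgn oppr0 if_same pos_eq0.
pose G (z : sphere R d) (v : 'I_d.+1 * bool) := pos (sgn v.2 (cart z v.1)).
have posG z i : G z (i, true) - G z (i, false) = cart z i by exact: pos_subN.
have [v|z v|z|z|g cg gE] := @into_realization R _ K (sphere R d) G.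
- by apply: pos_continuous; apply: sgn_continuous; exact: cart_continuous.
- exact: pos_ge0.
- rewrite KE; apply/forallP => i; rewrite !inE negb_and !negbK /G /=.
  have [z0|z0] := leP 0 (cart z i).
    by rewrite [X in _ || (X == _)]pos_eq0 ?eqxx ?orbT// oppr_le0.
  by rewrite pos_eq0 ?eqxx// ltW.
- have [i zi] := cart_neq0 z; have := posG z i.
  have [Gt _|Gt] := eqVneq (G z (i, true)) 0; last by exists (i, true).
  by exists (i, false); apply: contraNneq zi => Gf; rewrite -posG Gt Gf subrr.
have Gs z : 0 < \sum_u G z u.
  rewrite lt0r sumr_ge0 ?andbT; last by move=> v _; exact: pos_ge0.
  have [_ g1 _] := realizationP (g z); apply: contra_eqN g1 => /eqP G0.
  by under eq_bigr do rewrite gE G0 invr0 mulr0; rewrite big1// eq_sym oner_neq0.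
apply: (@homeomorphic_equivalent _ _ _ f g) => // [x|z].
- apply: realization_inj => v; rewrite gE.
  have [_ x1 _] := realizationP x.
  have -> : bary x v = normalize1 (bary x) v by rewrite /normalize1 x1 divr1.
  rewrite -[LHS]/(normalize1 (G (f x)) v).
  have s0 : 0 < Num.sqrt (\sum_j F x j ^+ 2).
    rewrite sqrtr_gt0; apply: sum_sqr_gt0.
    have [i] := cart_neq0 (f x); rewrite fE /normalize2 mulf_eq0 negb_or => /andP[? _].
    by exists i.
  congr (_ v); apply: (@normalize1_scale _ (Num.sqrt (\sum_j F x j ^+ 2))^-1).
    by rewrite invr_gt0.
  move=> u; rewrite /G fE -posF -pos_scale ?invr_ge0 ?(ltW s0)//.
  by congr pos; rewrite /normalize2 /sgn; case: ifP; rewrite mulrC ?mulrN.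
- apply: sphere_inj => i; rewrite fE -[in RHS]normalize2_cart; congr (_ i).
  apply: (@normalize2_scale _ (\sum_u G z u)^-1); first by rewrite invr_gt0.
  by move=> k; rewrite /F !gE -mulrBl posG mulrC.
Qed.

End CrossPolytope.
End Spheres.

(** * The join of a sphere and a finite set *)

Section Wedge.
Local Open Scope classical_set_scope.
Local Open Scope ring_scope.
Variable R : realType.

Definition scons (d : nat) (a : R) (b : 'I_d -> R) (k : 'I_d.+1) : R :=
  if unlift ord0 k is Some i then b i else a.

Lemma scons0 d a (b : 'I_d -> R) : scons a b ord0 = a.
Proof. by rewrite /scons unlift_none. Qed.

Lemma sconsS d a (b : 'I_d -> R) i : scons a b (lift ord0 i) = b i.
Proof. by rewrite /scons liftK. Qed.

Lemma scons_continuous (Y : topologicalType) d (a : Y -> R) (b : Y -> 'I_d -> R)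
    k :
  continuous a -> (forall i, continuous (b^~ i)) ->
  continuous (fun y => scons (a y) (b y) k).
Proof. by rewrite /scons; case: (unlift ord0 k). Qed.

(** The join of the boundary of the cross-polytope with r + 1 points.  A point x
    has a coordinate [p x] at the first of these points, [q x j] at the j-th
    other one, and [u x] in the space spanned by the cross-polytope; at most one
    of [p x] and the [q x j] is nonzero.  So x lies in one of the r + 1 cones
    over the sphere, and for each j the union of the first and the j-th cone is
    a suspension, with height [p x - q x j].  The map to the wedge contracts the
    first cone and stretches the j-th one over the j-th sphere; the map back
    identifies the j-th sphere with the j-th suspension. *)
Section CrossJoin.
Variables (r' d : nat).
Let r := r'.+1.
Variable K : simplicial_complex ('I_r.+1 + 'I_d * bool)%type.
Hypothesis KE : forall A, (A \in faces K) =
  [forall j, forall k, (inl j \in A) && (inl k \in A) ==> (j == k)] &&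
  [forall i, ~~ ((inr (i, true) \in A) && (inr (i, false) \in A))].

Let X := realization R K.
Let S := sphere R d.
Let base : S := sphere_base R d.
Let WS := wedge_of_spheres R r d.
Let lft (j : 'I_r) : S -> WS := @wedge_lift _ _ (fun _ : 'I_r => base) j.

Let p (x : X) : R := bary x (inl ord0).
Let q (x : X) (j : 'I_r) : R := bary x (inl (lift ord0 j)).
Let u (x : X) (i : 'I_d) : R :=
  bary x (inr (i, true)) - bary x (inr (i, false)).
(* On the j-th cone the height 1 - 2 q runs from 1 on the sphere to -1 at the
   apex, and the factor q makes the point reach the base point on the sphere. *)
Let F (j : 'I_r) (x : X) : 'I_d.+1 -> R :=
  scons (1 - 2 * q x j) (fun i => q x j * u x i).
(* Membership in the union of the first and the j-th cone. *)
Let inC (x : X) (j : 'I_r) := forall k, k != j -> q x k = 0.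

Let inl_opp (x : X) j k : j != k -> bary x (inl j) = 0 \/ bary x (inl k) = 0.
Proof.
move=> jk; have [_ _] := realizationP x; rewrite KE.
move=> /andP[/forallP/(_ j)/forallP/(_ k) + _].
rewrite !inE (negPf jk) implybF negb_and !negbK.
by case/orP => /eqP; [left|right].
Qed.

Let inr_opp (x : X) i : bary x (inr (i, true)) * bary x (inr (i, false)) = 0.
Proof.
have [_ _] := realizationP x; rewrite KE => /andP[_ /forallP/(_ i)].
by rewrite !inE negb_and !negbK => x0; apply/eqP; rewrite mulf_eq0.
Qed.

Let pos_u (x : X) i c : pos (sgn c (u x i)) = bary x (inr (i, c)).
Proof.
by case: c => /=; rewrite /u ?opprB pos_diff ?bary_ge0 ?inr_opp// mulrC inr_opp.
Qed.

Let inr0 (x : X) : (forall i, u x i = 0) -> forall v, bary x (inr v) = 0.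
Proof. by move=> u0 [i c]; rewrite -pos_u u0 /sgn oppr0 if_same pos_eq0. Qed.

Let exC (x : X) : exists j, inC x j.
Proof.
have [[j qj]|] := pselect (exists j, q x j != 0).
  exists j => k kj; have [|//|q0] := @inl_opp x (lift ord0 k) (lift ord0 j).
    by rewrite (inj_eq lift_inj).
  by move: qj; rewrite /q q0 eqxx.
move=> nq; exists ord0 => k _; apply/eqP/negPn/negP => qk; apply: nq.
by exists k.
Qed.

Let pq0 (x : X) j : p x * q x j = 0.
Proof.
rewrite /p /q; have [|->|->] := @inl_opp x ord0 (lift ord0 j).
- by rewrite eq_liftF.
- by rewrite mul0r.
- by rewrite mulr0.
Qed.

Let sumC (x : X) j : inC x j ->
  \sum_v bary x v = p x + q x j + \sum_v bary x (inr v).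
Proof.
move=> xj; rewrite big_sumType /=; congr (_ + _).
rewrite big_ord_recl; congr (_ + _).
by rewrite (bigD1 j) //= big1 ?addr0// => k /xj.
Qed.

Let sum_q (x : X) j : inC x j -> \sum_k q x k = q x j.
Proof. by move=> xj; rewrite (bigD1 j) //= big1 ?addr0// => k /xj. Qed.

Let F_neq0 j (x : X) : exists k, F j x k != 0.
Proof.
have [q2|] := eqVneq (1 - 2 * q x j) 0; last first.
  by move=> q2; exists ord0; rewrite /F scons0.
have q0 : q x j != 0 by apply/eqP => q0; move: q2; rewrite q0; lra.
have xj : inC x j.
  move=> k kj; have [|//|q1] := @inl_opp x (lift ord0 k) (lift ord0 j).
    by rewrite (inj_eq lift_inj).
  by move: q0; rewrite /q q1 eqxx.
have p0 : p x = 0.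
  by apply/eqP; have /eqP := pq0 x j; rewrite mulf_eq0 (negPf q0) orbF.
have [[i ui]|nu] := pselect (exists i, u x i != 0).
  by exists (lift ord0 i); rewrite /F sconsS mulf_neq0.
have [_ x1 _] := realizationP x.
move: x1; rewrite (sumC xj) p0 big1; first by lra.
move=> v _; apply: inr0 => i; apply/eqP/negPn/negP => ui; apply: nu.
by exists i.
Qed.

Let cF j k : continuous (fun x : X => F j x k).
Proof.
have cq : continuous (fun x : X => q x j) by exact: bary_continuous.
apply: scons_continuous => [|i].
- apply: subr_continuous; first exact: cstr_continuous.
  by apply: mulr_continuous => //; exact: cstr_continuous.
- apply: mulr_continuous => //.
  by apply: subr_continuous; exact: bary_continuous.
Qed.

Let to_sphere j : {f : X -> S | continuous f &
  forall x, cart (f x) = normalize2 (F j x)}.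
Proof. by apply: cid2; apply: into_sphere; [exact: cF|exact: F_neq0]. Qed.
Let fs j : X -> S := s2val (to_sphere j).
Let fsC j : continuous (fs j) := s2valP (to_sphere j).
Let fsE j x : cart (fs j x) = normalize2 (F j x) := s2valP' (to_sphere j) x.

Let fs_base j x : q x j = 0 -> fs j x = base.
Proof.
move=> q0; apply: cart_base_eq; rewrite fsE /normalize2 big_ord_recl.
rewrite big1 => [|i _]; last by rewrite /F sconsS q0 mul0r expr0n.
by rewrite /F scons0 q0 mulr0 subr0 addr0 expr1n sqrtr1 divr1.
Qed.

Let lft_base j k : lft j base = lft k base.
Proof. exact: (@wedge_liftE _ _ (fun _ : 'I_r => base) k base j base). Qed.

(* The choice of j is immaterial: a point of two of the suspensions is in the
   first cone, and goes to the base point. *)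
Let f (x : X) : WS := lft (projT1 (cid (exC x))) (fs (projT1 (cid (exC x))) x).

Let fE x j : inC x j -> f x = lft j (fs j x).
Proof.
rewrite /f; case: (cid _) => k xk xj /=.
have [->//|kj] := eqVneq k j.
rewrite (fs_base (xj k kj)) (@fs_base j); first exact: lft_base.
by apply: xk; rewrite eq_sym.
Qed.

Let lftC j : continuous (lft j).
Proof. exact: (@wedge_lift_continuous 'I_r (fun=> S) (fun=> base) j). Qed.

Let fC : continuous f.
Proof.
(* Gluing over the finite closed cover by the suspensions: near x, only those
   which contain x matter. *)
move=> x U Ux.
have : \forall y \near x, forall j, inC y j -> U (lft j (fs j y)).
  apply: (@filter_forall X 'I_r (fun j y => inC y j -> U (lft j (fs j y))) _
    (nbhs_filter x)).
  move=> j; have [xj|xNj] := pselect (inC x j).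
    have /= := comp_continuous (@fsC j) (@lftC j) => /(_ x U); rewrite /= -fE//.
    move=> /(_ Ux) xU.
    by apply: (@filterS _ _ (nbhs_filter x) _ _ _ xU) => y Uy _.
  have [k kj qk] : exists2 k, k != j & q x k != 0.
    apply: contrapT => nk; apply: xNj => k kj.
    by apply/eqP/negPn/negP => qk; apply: nk; exists k.
  have cq : continuous (fun x : X => q x k) by exact: bary_continuous.
  have : \forall y \near x, q y k != 0.
    have /cvgr_neq0 := cq x; exact.
  move=> xq; apply: (@filterS _ _ (nbhs_filter x) _ _ _ xq) => y /eqP + yj.
  by rewrite yj.
move=> xU; apply: (@filterS _ _ (nbhs_filter x) _ _ _ xU) => y Uy /=.
have [j yj] := exC y.
by rewrite (fE yj); exact: Uy.
Qed.

(* Barycentric coordinates, up to a factor, of the point of the j-th suspension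
   in the direction z. *)
Let G (j : 'I_r) (z : 'I_d.+1 -> R) (v : 'I_r.+1 + 'I_d * bool) : R :=
  match v with
  | inl k => scons (pos (z ord0))
               (fun k => if k == j then pos (- z ord0) else 0) k
  | inr (i, c) => pos (sgn c (z (lift ord0 i)))
  end.

Let G_ge0 j z v : 0 <= G j z v.
Proof.
case: v => [k|[i c]]; last exact: pos_ge0.
rewrite /G; have [k' ->|->] := unliftP ord0 k; rewrite ?scons0 ?sconsS.
  by case: ifP => // _; exact: pos_ge0.
exact: pos_ge0.
Qed.

Let G_scale j z c v : 0 <= c -> G j (fun k => c * z k) v = c * G j z v.
Proof.
move=> c0; case: v => [k|[i b]] /=; last first.
  by rewrite -pos_scale//; congr pos; case: b => //=; rewrite mulrN.
have [k' ->|->] := unliftP ord0 k; rewrite ?scons0 ?sconsS ?pos_scale//.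
by case: ifP; rewrite ?mulr0// -mulrN pos_scale.
Qed.

Let G0 j z : G j z (inl ord0) - G j z (inl (lift ord0 j)) = z ord0.
Proof. by rewrite /G scons0 sconsS eqxx pos_subN. Qed.

Let GS j z i : G j z (inr (i, true)) - G j z (inr (i, false)) = z (lift ord0 i).
Proof. exact: pos_subN. Qed.

Let G_face j z : supp (G j z) \in faces K.
Proof.
rewrite KE; apply/andP; split; last first.
  apply/forallP => i; rewrite !inE negb_and !negbK /G /=.
  have [z0|z0] := leP 0 (z (lift ord0 i)).
    by rewrite [X in _ || (X == _)]pos_eq0 ?eqxx ?orbT// oppr_le0.
  by rewrite pos_eq0 ?eqxx// ltW.
have lone k : k != j -> G j z (inl (lift ord0 k)) = 0.
  by move=> /negPf kj; rewrite /G sconsS kj.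
have opp : (G j z (inl ord0) == 0) || (G j z (inl (lift ord0 j)) == 0).
  rewrite /G scons0 sconsS eqxx; have [z0|z0] := leP 0 (z ord0).
    by rewrite [X in _ || (X == _)]pos_eq0 ?eqxx ?orbT// oppr_le0.
  by rewrite pos_eq0 ?eqxx// ltW.
apply/forallP => k; apply/forallP => l; apply/implyP; rewrite !inE.
have [k' ->|->] := unliftP ord0 k; have [l' ->|->] := unliftP ord0 l => //.
- have [->|/lone ->] := eqVneq k' j; last by rewrite eqxx.
  have [->|/lone ->] := eqVneq l' j; last by rewrite eqxx andbF.
  by rewrite eqxx.
- have [->|/lone ->] := eqVneq k' j; last by rewrite eqxx.
  by rewrite -negb_or orbC opp.
- have [->|/lone ->] := eqVneq l' j; last by rewrite eqxx andbF.
  by rewrite -negb_or opp.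
Qed.

Let G_neq0 j z : (exists k, z k != 0) -> exists v, G j z v != 0.
Proof.
move=> [k zk]; apply: contrapT => nv.
have Gv v : G j z v = 0 by apply/eqP/negPn/negP => Gv; apply: nv; exists v.
move: zk; have [i ->|->] := unliftP ord0 k; first by rewrite -(GS j) !Gv subrr eqxx.
by rewrite -(G0 j) !Gv subrr eqxx.
Qed.

Let sumG_gt0 j z : (exists k, z k != 0) -> 0 < \sum_v G j z v.
Proof.
move=> /(G_neq0 j)[v Gv]; rewrite (bigD1 v) //=.
by rewrite ltr_pwDl ?lt0r ?Gv ?G_ge0// sumr_ge0.
Qed.

Let cG (Y : topologicalType) (Z : Y -> 'I_d.+1 -> R) j v :
  (forall k, continuous (Z^~ k)) -> continuous (fun y => G j (Z y) v).
Proof.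
move=> cZ; case: v => [k|[i c]]; last first.
  by apply: pos_continuous; apply: sgn_continuous; exact: cZ.
rewrite /G; apply: scons_continuous => [|i].
  by apply: pos_continuous; exact: cZ.
case: (i == j); last exact: cstr_continuous.
by apply: pos_continuous; apply: (@sgn_continuous _ _ false); exact: cZ.
Qed.

Let of_sphere j : {g : S -> X | continuous g &
  forall z v, bary (g z) v = normalize1 (G j (cart z)) v}.
Proof.
apply: cid2; apply: into_realization.
- by move=> v; apply: cG; exact: cart_continuous.
- by move=> z v; exact: G_ge0.
- by move=> z; exact: G_face.
- by move=> z; apply: G_neq0; exact: cart_neq0.
Qed.
Let gs j : S -> X := s2val (of_sphere j).
Let gsC j : continuous (gs j) := s2valP (of_sphere j).
Let gsE j z v : bary (gs j z) v = normalize1 (G j (cart z)) v :=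
  s2valP' (of_sphere j) z v.

Let gs_base j k : gs j base = gs k base.
Proof.
apply: realization_inj => v; rewrite !gsE; congr (_ v); congr normalize1.
apply/funext => -[l|//]; have [l' ->|->] := unliftP ord0 l; last first.
  by rewrite /G !scons0.
by rewrite /G !sconsS cart_base eqxx pos_eq0 ?if_same// oppr_le0 ler01.
Qed.

Let g : WS -> X := wedge_fun (fun j : 'I_r => gs j : S -> X).

Let gC : continuous g.
Proof. by apply: wedge_fun_continuous; [exact: gsC|exact: gs_base]. Qed.

Let gE j z : g (lft j z) = gs j z.
Proof. by rewrite /g wedge_lift_funE//; exact: gs_base. Qed.

Let gs_inC j z : inC (gs j z) j.
Proof. by move=> k /negPf kj; rewrite /q gsE /normalize1 /G sconsS kj mul0r. Qed.

Let fsG_scale j x :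
  normalize1 (G j (cart (fs j x))) = normalize1 (G j (F j x)).
Proof.
have s0 := sum_sqr_gt0 (F_neq0 j x).
apply: (@normalize1_scale _ _ (Num.sqrt (\sum_k F j x k ^+ 2))^-1).
  by rewrite invr_gt0 sqrtr_gt0.
move=> v; rewrite -G_scale; last by rewrite invr_ge0 sqrtr_ge0.
by congr (G j _ v); apply/funext => k; rewrite fsE /normalize2 mulrC.
Qed.

(* A path of directions in the j-th suspension, from x itself at t = 0 to
   [F j x] at t = 1. *)
Let P (j : 'I_r) (x : X) (t : R) : 'I_d.+1 -> R :=
  scons ((1 - t) * (p x - q x j) + t * (1 - 2 * q x j))
        (fun i => ((1 - t) + t * q x j) * u x i).

Let P_neq0 j x t : inC x j -> 0 <= t <= 1 -> exists k, P j x t k != 0.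
Proof.
move=> xj /andP[t0 t1]; apply: contrapT => nP.
have P0 k : P j x t k = 0 by apply/eqP/negPn/negP => Pk; apply: nP; exists k.
have := P0 ord0; rewrite /P scons0 => h0.
have hS i : ((1 - t) + t * q x j) * u x i = 0.
  by have := P0 (lift ord0 i); rewrite /P sconsS.
have p0 : 0 <= p x by exact: bary_ge0.
have q0 : 0 <= q x j by exact: bary_ge0.
have pq := pq0 x j.
have [l0|l0] := eqVneq ((1 - t) + t * q x j) 0.
  have tq : 0 <= t * q x j by rewrite mulr_ge0.
  have t_1 : t = 1 by lra.
  by move: l0 h0; rewrite t_1; lra.
have u0 i : u x i = 0.
  by have /eqP := hS i; rewrite mulf_eq0 (negPf l0) => /eqP.
have [_ x1 _] := realizationP x.
move: x1; rewrite (sumC xj) big1 => [|v _]; last exact: inr0.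
move/eqP: pq; rewrite mulf_eq0 => /orP[]/eqP e; move: h0; rewrite e => h0 h1.
  have q1 : q x j = 1 by lra.
  by move: h0; rewrite q1; lra.
have p1 : p x = 1 by lra.
by move: h0; rewrite p1; lra.
Qed.

(* The coordinates [G j (P j x t)] written without j, so that they are visibly
   continuous on the whole join. *)
Let D (x : X) (t : R) (v : 'I_r.+1 + 'I_d * bool) : R :=
  let s := \sum_k q x k in
  match v with
  | inl k => scons (pos ((1 - t) * (p x - s) + t * (1 - 2 * s)))
      (fun k => pos ((1 - t) * (q x k - p x) + t * (2 * q x k - 1))) k
  | inr w => ((1 - t) + t * s) * bary x (inr w)
  end.

Let DE j x t : inC x j -> 0 <= t <= 1 -> D x t = G j (P j x t).
Proof.
move=> xj /andP[t0 t1]; apply/funext => -[k|[i c]]; rewrite /D (sum_q xj); last first.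
  rewrite /G /P sconsS -pos_u.
  have l0 : 0 <= 1 - t + t * q x j.
    by rewrite addr_ge0 ?subr_ge0// mulr_ge0// bary_ge0.
  by rewrite -pos_scale//; congr pos; case: c => //=; rewrite mulrN.
have [k' ->|->] := unliftP ord0 k; last by rewrite /G /P !scons0.
rewrite /G /P !sconsS !scons0; have [->|kj] := eqVneq k' j.
  by congr pos; lra.
rewrite xj// pos_eq0//.
have : 0 <= (1 - t) * p x by rewrite mulr_ge0 ?subr_ge0 ?bary_ge0.
by lra.
Qed.

Let cD v : continuous (fun xt : X * R => D xt.1 (1 - clamp xt.2) v).
Proof.
have cb w : continuous (fun xt : X * R => bary xt.1 w).
  exact: comp_continuous (@fst_continuous _ _) (@bary_continuous _ _ _ w).
have cc : continuous (fun xt : X * R => clamp xt.2).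
  by apply: clamp_continuous; exact: snd_continuous.
have c1 : continuous (fun xt : X * R => (1 - clamp xt.2 : R)).
  by apply: subr_continuous => //; exact: cstr_continuous.
have c2 : continuous (fun xt : X * R => (1 - (1 - clamp xt.2) : R)).
  by apply: subr_continuous => //; exact: cstr_continuous.
have cs : continuous (fun xt : X * R => \sum_k q xt.1 k : R).
  by apply: sumr_continuous => k _; exact: cb.
case: v => [k|w] /=; last first.
  by apply: mulr_continuous => //; apply: addr_continuous => //;
    exact: mulr_continuous.
apply: scons_continuous => [|i]; apply: pos_continuous;
  apply: addr_continuous; apply: mulr_continuous => //.
- by apply: subr_continuous => //; exact: cb.
- apply: subr_continuous; first exact: cstr_continuous.
  by apply: mulr_continuous => //; exact: cstr_continuous.
- by apply: subr_continuous; exact: cb.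
- apply: subr_continuous; last exact: cstr_continuous.
  by apply: mulr_continuous; [exact: cstr_continuous|exact: cb].
Qed.

Let clampC (t : R) : 0 <= 1 - clamp t <= 1.
Proof. by have /andP[] := clamp_itv t => c0 c1; apply/andP; split; lra. Qed.

Let gf_deforms : deforms R (g \o f) idfun.
Proof.
have [xt v|xt|xt|H cH HE] :=
  @into_realization R _ K (X * R)%type (fun xt => D xt.1 (1 - clamp xt.2)) cD.
- by have [j xj] := exC xt.1; rewrite (DE xj) ?clampC// G_ge0.
- by have [j xj] := exC xt.1; rewrite (DE xj) ?clampC// G_face.
- have [j xj] := exC xt.1; rewrite (DE xj) ?clampC//; apply: G_neq0.
  by apply: P_neq0 => //; exact: clampC.
exists H; split=> // x; have [j xj] := exC x; apply: realization_inj => v.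
- rewrite HE /= (fE xj) gE gsE fsG_scale clamp0 subr0 (DE xj) ?ler01 ?lexx//.
  rewrite -[LHS]/(normalize1 (G j (P j x 1)) v).
  congr (normalize1 (G j _) v); apply/funext => k; rewrite /P /F.
  have [i ->|->] := unliftP ord0 k; rewrite ?sconsS ?scons0.
    by rewrite subrr add0r mul1r.
  by rewrite subrr mul0r add0r mul1r.
- have [_ x1 _] := realizationP x; rewrite HE /= clamp1 subrr.
  rewrite [RHS](_ : _ = normalize1 (bary x) v); last by rewrite /normalize1 x1 divr1.
  rewrite -[LHS]/(normalize1 (D x 0) v); congr (normalize1 _ v).
  rewrite (DE xj) ?ler01 ?lexx//.
  apply/funext => -[k|[i c]]; rewrite /G /P ?sconsS ?scons0; last first.
    by rewrite subr0 mul0r addr0 mul1r pos_u.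
  have pq := pq0 x j.
  have e : (1 - 0) * (p x - q x j) + 0 * (1 - 2 * q x j) = p x - q x j by lra.
  have [k' ->|->] := unliftP ord0 k; rewrite ?sconsS ?scons0 e; last first.
    by rewrite pos_diff ?bary_ge0.
  have [->|kj] := eqVneq k' j; last by rewrite -[RHS]/(q x k') xj.
  by rewrite opprB pos_diff ?bary_ge0// mulrC.
Qed.

(* A straight path from the image of z under the two maps in succession to z.
   It avoids the origin since its ends never point in opposite directions. *)
Let Q (j : 'I_r) (z : S) (t : R) (k : 'I_d.+1) : R :=
  (1 - t) * F j (gs j z) k + t * cart z k.

Let Q_neq0 j z t : 0 <= t <= 1 -> exists k, Q j z t k != 0.
Proof.
move=> /andP[t0 t1]; apply: contrapT => nQ.
have Q0 k : Q j z t k = 0 by apply/eqP/negPn/negP => Qk; apply: nQ; exists k.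
have S0 := sumG_gt0 j (cart_neq0 z).
set s := \sum_v G j (cart z) v in S0.
have qE : q (gs j z) j = pos (- cart z ord0) / s.
  by rewrite /q gsE /normalize1 /G sconsS eqxx.
have uE i : u (gs j z) i = cart z (lift ord0 i) / s.
  by rewrite /u !gsE /normalize1 -/s -mulrBl GS.
have q0 : 0 <= q (gs j z) j by exact: bary_ge0.
have := Q0 ord0; rewrite /Q /F scons0 => h0.
have hS i : cart z (lift ord0 i) * ((1 - t) * q (gs j z) j / s + t) = 0.
  have := Q0 (lift ord0 i); rewrite /Q /F sconsS uE => <-.
  by rewrite mulrDr [t * _]mulrC; congr (_ + _); rewrite mulrC -!mulrA;
    congr (_ * (_ * _)); rewrite mulrC.
have [l0|l0] := eqVneq ((1 - t) * q (gs j z) j / s + t) 0.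
  have l1 : 0 <= (1 - t) * q (gs j z) j / s.
    by rewrite divr_ge0 ?(ltW S0)// mulr_ge0// subr_ge0.
  have t_0 : t = 0 by lra.
  move: l0; rewrite t_0 subr0 mul1r addr0 => /eqP.
  rewrite mulf_eq0 invr_eq0 (gt_eqF S0) orbF => /eqP qz.
  by move: h0; rewrite t_0 qz; lra.
have z0 i : cart z (lift ord0 i) = 0.
  by have /eqP := hS i; rewrite mulf_eq0 (negPf l0) orbF => /eqP.
have := cart_sum z; rewrite big_ord_recl big1 => [|i _]; last first.
  by rewrite z0 expr0n.
rewrite addr0 => /eqP; rewrite sqrf_eq1 => /orP[]/eqP zE.
  move: h0; rewrite qE zE pos_eq0 ?mul0r; last by lra.
  by lra.
have u0 i : u (gs j z) i = 0 by rewrite uE z0 mul0r.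
have p0 : p (gs j z) = 0.
  by rewrite /p gsE /normalize1 /G scons0 zE pos_eq0 ?mul0r//; lra.
have [_ x1 _] := realizationP (gs j z).
move: x1; rewrite (sumC (@gs_inC j z)) p0 big1 => [q1|v _]; last exact: inr0.
have q_1 : q (gs j z) j = 1 by lra.
by move: h0; rewrite zE q_1; lra.
Qed.

Let slide j : {h : R * S -> S | continuous h &
  forall tz, cart (h tz) = normalize2 (Q j tz.2 (clamp tz.1))}.
Proof.
apply: cid2; apply: into_sphere => [k|tz]; last first.
  by apply: Q_neq0; exact: clamp_itv.
have cc : continuous (fun tz : R * S => clamp tz.1).
  by apply: clamp_continuous; exact: fst_continuous.
apply: addr_continuous; apply: mulr_continuous => //.
- by apply: subr_continuous => //; exact: cstr_continuous.
- apply: (comp_continuous _ (@cF j k)).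
  exact: (comp_continuous (@snd_continuous _ _) (@gsC j)).
- exact: (comp_continuous (@snd_continuous _ _) (@cart_continuous _ _ k)).
Qed.
Let hs j : R * S -> S := s2val (slide j).
Let hsC j : continuous (hs j) := s2valP (slide j).
Let hsE j tz : cart (hs j tz) = normalize2 (Q j tz.2 (clamp tz.1)) :=
  s2valP' (slide j) tz.

Let hs_base j t : hs j (t, base) = base.
Proof.
have q0 : q (gs j base) j = 0.
  rewrite /q gsE /normalize1 /G sconsS eqxx cart_base eqxx.
  by rewrite pos_eq0 ?mul0r// oppr_le0 ler01.
apply: cart_base_eq; rewrite hsE /=.
rewrite (_ : normalize2 _ ord0 = normalize2 (cart base) ord0).
  by rewrite normalize2_cart cart_base eqxx.
congr (_ ord0); apply: (@normalize2_scale _ _ 1) => // k.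
rewrite /Q /F mul1r cart_base; have [i ->|->] := unliftP ord0 k.
  by rewrite sconsS q0 mul0r mulr0 mulr0 addr0.
by rewrite scons0 q0 eqxx mulr0 subr0 !mulr1 subrK.
Qed.

Let fg_deforms : deforms R (f \o g) idfun.
Proof.
pose H (t : R) : WS -> WS :=
  wedge_fun (fun j : 'I_r => (fun z => lft j (hs j (t, z))) : S -> WS).
have HE j t z : H t (lft j z) = lft j (hs j (t, z)).
  by rewrite /H wedge_lift_funE// => k l; rewrite !hs_base; exact: lft_base.
have cH : continuous (uncurry H : R * WS -> WS).
  apply: (@wedge_fun_joint_continuous 'I_r (fun=> S) (fun=> base) R WS
    (fun j t z => lft j (hs j (t, z)))).
  - exact: finite_finset.
  - move=> j; rewrite (_ : [set base] = (fun z => cart z ord0) @^-1` [set 1]).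
      apply: preimage_closed => [z _|]; first exact: cart_continuous.
      exact: closed_eq.
    apply/seteqP; split=> z /=; last exact: cart_base_eq.
    by move=> ->; rewrite cart_base eqxx.
  - by move=> t j k; rewrite !hs_base; exact: lft_base.
  - move=> j; rewrite (_ : uncurry _ = lft j \o hs j); last first.
      by apply/funext => -[].
    exact: comp_continuous (@hsC j) (@lftC j).
have lftP (w : WS) : exists j z, w = lft j z.
  have : (\bigcup_i (@wedge_lift _ _ (fun _ : 'I_r => base) i @` setT)) w.
    by rewrite wedgeTE.
  by move=> [j _ [z _ <-]]; exists j, z.
exists (fun wt => H wt.2 wt.1); split=> [|w|w].
- apply: (comp_continuous _ cH :
    continuous (uncurry H \o (fun wt : WS * R => (wt.2, wt.1)))).
  apply: pair_continuous; [exact: snd_continuous|exact: fst_continuous].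
- have [j [z ->]] := lftP w; rewrite /= HE gE (fE (@gs_inC j z)); congr lft.
  apply: sphere_inj => k; rewrite hsE fsE; congr (normalize2 _ k).
  by apply/funext => l; rewrite /Q clamp0 subr0 mul1r mul0r addr0.
- have [j [z ->]] := lftP w; rewrite /= HE; congr lft.
  apply: sphere_inj => k; rewrite hsE -[in RHS]normalize2_cart; congr (normalize2 _ k).
  by apply/funext => l; rewrite /Q clamp1 subrr mul0r add0r mul1r.
Qed.

Lemma cross_join_wedge :
  equivalent R (realization R K) (wedge_of_spheres R r d).
Proof.
by exists f, g; split; [exact: fC|exact: gC|exact: gf_deforms|exact: fg_deforms].
Qed.

End CrossJoin.
End Wedge.

(** * Conflict-free sets *)

Section Independence.
Variable W : finType.

(** An element related to itself is not a vertex of the complex: deleting vertices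
    amounts to enlarging the relation. *)
Definition indep_faces (e : rel W) : {set {set W}} :=
  [set A : {set W} | [forall u in A, forall v in A, ~~ e u v]].

Lemma indepP (e : rel W) (A : {set W}) :
  reflect (forall u v, u \in A -> v \in A -> ~~ e u v) (A \in indep_faces e).
Proof.
rewrite inE; apply: (iffP forall_inP) => [eA u v uA vA|eA u uA].
  by have /forall_inP := eA u uA; apply.
by apply/forall_inP => v vA; exact: eA.
Qed.

Lemma indep_sub (e : rel W) (A B : {set W}) :
  A \in indep_faces e -> B \subset A -> B \in indep_faces e.
Proof.
move=> /indepP eA /fintype.subsetP BA.
by apply/indepP => u v /BA uA /BA vA; exact: eA.
Qed.

Definition indep (e : rel W) := SimplicialComplex (@indep_sub e).

Lemma indepU1 (e : rel W) (a : W) (A : {set W}) :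
  symmetric e -> ~~ e a a -> A \in indep_faces e ->
  (forall v, v \in A -> ~~ e a v) -> a |: A \in indep_faces e.
Proof.
move=> se ea /indepP eA aA; apply/indepP => u v; rewrite !inE.
by move=> /predU1P[->|uA] /predU1P[->|vA] //; [exact: aA|rewrite se aA|exact: eA].
Qed.

End Independence.

Section Pullback.
Variables (V W : finType) (e : W -> V) (K : simplicial_complex V).

Definition pullback_faces : {set {set W}} :=
  [set A : {set W} | e @: A \in faces K].

Lemma pullback_sub (A B : {set W}) :
  A \in pullback_faces -> B \subset A -> B \in pullback_faces.
Proof. by rewrite !inE => eA /(imsetS e); exact: faces_sub. Qed.

Definition pullback := SimplicialComplex pullback_sub.

Lemma pullback_equivalent (R : realType) : injective e ->
  (forall t v, t \in faces K -> v \in t -> exists w, v = e w) ->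
  equivalent R (realization R K) (realization R pullback).
Proof.
move=> einj eK; apply: (vertex_map_equivalent _ einj eK) => A.
by rewrite inE.
Qed.

End Pullback.

Lemma ord_enumeration (T : finType) (d : nat) :
  #|T| = d -> exists f : 'I_d -> T, bijective f.
Proof. by move=> <-; exists enum_val; exact: enum_val_bij. Qed.

(** * The edges of the windmill *)

Section Windmill.
Variables (R : realType) (m n : nat).
Hypothesis m3 : 3 <= m.
Local Notation W := ('I_n * 'I_m)%type.
Implicit Types (u v : W) (t : {set W}).

Definition central (j : 'I_m) : bool := (j == 0 :> nat) || (j.+1 == m).

(** The pair (i, j) stands for the edge e_j of copy i.  When [z] holds, the
    conflict between e_0 and e_1 is dropped; the edges satisfying [B] conflict
    with themselves, which deletes them. *)
Definition conflict (z : bool) (B : pred 'I_m) u v : bool :=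
  [|| [&& u.1 == v.1, (u.2.+1 == v.2) || (v.2.+1 == u.2) &
          z ==> (0 < u.2) && (0 < v.2)],
      [&& u != v, central u.2 & central v.2] |
      (u == v) && B u.2].

Lemma conflict_sym z B : symmetric (conflict z B).
Proof.
move=> u v; rewrite /conflict [u.1 == _]eq_sym [u == v]eq_sym orbC.
rewrite [(u.2.+1 == _) || _]orbC [(0 < u.2) && _]andbC [central u.2 && _]andbC.
rewrite orbC; congr [|| _, _ | _].
by case: eqVneq => // ->.
Qed.

Definition windmill_edge u : {set windmill_vertex m n} :=
  windmill_copy u.1 @: [set u.2; ordS u.2].

Lemma windmill_copy_eq (i i' : 'I_n) (a b : 'I_m) :
  windmill_copy i a = windmill_copy i' b <->
  (a = b :> nat) /\ (i = i' \/ a = 0 :> nat).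
Proof.
rewrite /windmill_copy; case: insubP => [a' a0 aE|/negPn/eqP a0];
  case: insubP => [b' b0 bE|/negPn/eqP b0] /=.
- split=> [[-> ab]|[ab]]; first by rewrite -aE -bE ab; split=> //; left.
  case=> [->|az]; last by move: a0; rewrite /= az.
  by congr (Some (_, _)); apply: val_inj; apply: val_inj; rewrite /= aE bE.
- by split=> // -[ab _]; move: a0; rewrite /= ab b0.
- by split=> // -[ab _]; move: b0; rewrite /= -ab a0.
- by split=> // _; split; [rewrite a0 b0|right].
Qed.

Lemma ordS_eq (j a : 'I_m) : (a = ordS j) <->
  (j.+1 < m /\ a = j.+1 :> nat \/ j.+1 = m /\ a = 0 :> nat).
Proof.
have jm := ltn_ord j.
have : val (ordS j) = j.+1 %% m by [].
have [jm1|jm1] := ltnP j.+1 m.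
  rewrite modn_small// => E; split=> [->|[[_ aE]|[aE _]]].
  - by left; rewrite E.
  - by apply: val_inj; rewrite E.
  - by exfalso; lia.
have jE : j.+1 = m by lia.
rewrite jE modnn => E; split=> [->|[[aE _]|[_ aE]]].
- by right.
- by exfalso; lia.
- by apply: val_inj; rewrite E.
Qed.

Lemma in_windmill_edge x u : reflect
  (exists a : 'I_m, x = windmill_copy u.1 a /\
     (a = u.2 :> nat \/ u.2.+1 < m /\ a = u.2.+1 :> nat \/
      u.2.+1 = m /\ a = 0 :> nat))
  (x \in windmill_edge u).
Proof.
apply: (iffP imsetP) => [[a]|[a [-> aE]]].
  rewrite !inE => /orP[/eqP ->|/eqP/ordS_eq aE] ->; first by exists u.2; split; [|left].
  by exists a; split; [|right].
exists a => //; rewrite !inE; case: aE => [/val_inj ->|/ordS_eq ->].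
  by rewrite eqxx.
by rewrite eqxx orbT.
Qed.

Lemma meet_conflict u v x : u != v ->
  x \in windmill_edge u -> x \in windmill_edge v ->
  conflict false pred0 u v.
Proof.
case: u v => [i a] [i' b] uv /in_windmill_edge[c [-> /= cE]].
move=> /in_windmill_edge[c' [/windmill_copy_eq[cc ii] /= c'E]].
have am := ltn_ord a; have bm := ltn_ord b.
rewrite /conflict uv /central /= andbF orbF andbT.
have ab : i = i' -> a <> b :> nat.
  by move=> ii' /val_inj ab'; move: uv; rewrite ii' ab' eqxx.
have [ie|ie] /= := eqVneq i i'; first by have := ab ie; lia.
by case: ii => [ii|c0]; [move: ie; rewrite ii eqxx|lia].
Qed.

Lemma conflict_meet u v : conflict false pred0 u v ->
  exists2 x, x \in windmill_edge u & x \in windmill_edge v.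
Proof.
case: u v => [i a] [i' b]; have am := ltn_ord a; have bm := ltn_ord b.
have m0 : 0 < m by lia.
rewrite /conflict /= andbF orbF => /orP[/and3P[/eqP <- ab _]|/and3P[_ ca cb]].
  case/orP: ab => /eqP ab.
    exists (windmill_copy i b); apply/in_windmill_edge; exists b => /=; split=> //.
      by right; left; split; [rewrite ab|].
    by left.
  exists (windmill_copy i a); apply/in_windmill_edge; exists a => /=; split=> //.
    by left.
  by right; left; split; [rewrite ab|].
exists (windmill_copy i (Ordinal m0)); apply/in_windmill_edge; exists (Ordinal m0) => /=.
  by split=> //; case/orP: ca => /eqP; [left|right; right].
split; last by case/orP: cb => /eqP; [left|right; right].
by apply/windmill_copy_eq; split=> //; right.
Qed.

Lemma windmill_edge_inj : injective windmill_edge.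
Proof.
move=> u v uv.
have sub x : x \in windmill_edge u -> x \in windmill_edge v by rewrite uv.
case: u v uv sub => [i a] [i' b] _ sub.
have am := ltn_ord a; have bm := ltn_ord b.
have S1 : windmill_copy i a \in windmill_edge (i', b).
  by apply: sub; apply/in_windmill_edge; exists a; split=> //; left.
have S2 : windmill_copy i (ordS a) \in windmill_edge (i', b).
  by apply: sub; apply/in_windmill_edge; exists (ordS a); split=> //; right; apply/ordS_eq.
have /ordS_eq aE : ordS a = ordS a by [].
move: S1 S2 => /in_windmill_edge[c [/windmill_copy_eq[ac ic] /= cE]].
move=> /in_windmill_edge[c' [/windmill_copy_eq[ac' ic'] /= c'E]].
have ab : a = b by apply: val_inj => /=; lia.
by rewrite -ab; case: ic => [->//|a0]; case: ic' => [->//|a1]; exfalso; lia.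
Qed.

Lemma windmill_edgesP x :
  reflect (exists u, x = windmill_edge u) (x \in windmill_edges m n).
Proof.
apply: (iffP imset2P) => [[i y _ /imsetP[j _ ->] ->]|[[i j] ->]].
  by exists (i, j).
by exists i [set j; ordS j] => //; apply/imsetP; exists j.
Qed.

Lemma matching_equivalent :
  equivalent R (realization R (matching_complex (windmill_edges m n)))
               (realization R (indep (conflict false pred0))).
Proof.
apply: (vertex_map_equivalent _ windmill_edge_inj).
- move=> t v; rewrite inE => /andP[/fintype.subsetP tE _] vt.
  exact/windmill_edgesP/tE.
- move=> A; rewrite [RHS]inE; apply/indepP/andP => [eA|[_ /forallP A1] u v uA vA].
    split.
      by apply/fintype.subsetP => _ /imsetP[u _ ->]; apply/windmill_edgesP; exists u.
    apply/forallP => x; apply/card_le1_eqP => y z.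
    rewrite !inE => /andP[/imsetP[u uA ->] xu] /andP[/imsetP[v vA ->] xv].
    have [->//|uv] := eqVneq u v.
    by move: (eA u v uA vA); rewrite (meet_conflict uv xu xv).
  apply/negP => uv; have [x xu xv] := conflict_meet uv.
  have /card_le1_eqP/(_ (windmill_edge u) (windmill_edge v)) := A1 x.
  rewrite !inE !imset_f// xu xv => /(_ isT isT)/windmill_edge_inj uv'.
  by move: uv; rewrite uv' /conflict !eqxx /= andbT !orbF; lia.
Qed.

Lemma m_gt0 : 0 < m.
Proof. exact: leq_trans m3. Qed.

(** The edge e_j of copy i; the value is e_0 when j is out of range. *)
Definition edge_at (i : 'I_n) (j : nat) : W := (i, insubd (Ordinal m_gt0) j).

Lemma edge_at2 i j : j < m -> (edge_at i j).2 = j :> nat.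
Proof. by move=> jm; rewrite /= val_insubd jm. Qed.

Lemma edge_atE u i j : j < m -> u.1 = i -> u.2 = j :> nat -> u = edge_at i j.
Proof.
case: u => i' j' /= jm -> jE; congr (_, _); apply: val_inj.
by rewrite /= val_insubd jm.
Qed.

Lemma indep_path z B t u v : t \in faces (indep (conflict z B)) ->
  u \in t -> v \in t -> u.1 = v.1 -> u.2.+1 = v.2 -> (z -> 0 < u.2) -> False.
Proof.
move=> /indepP eA uA vA uv1 uv2 uz; move: (eA u v uA vA).
by rewrite /conflict uv1 eqxx uv2 eqxx /= -uv2 andbT; case: z uz {eA} => // ->.
Qed.

Lemma indep_central z B t u v : t \in faces (indep (conflict z B)) ->
  u \in t -> v \in t -> central u.2 -> central v.2 -> u = v.
Proof.
move=> /indepP eA uA vA cu cv; move: (eA u v uA vA).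
by rewrite /conflict cu cv andbT; case: (eqVneq u v) => // _; rewrite orbT.
Qed.

Lemma indep_excluded z B t u : t \in faces (indep (conflict z B)) ->
  u \in t -> ~~ B u.2.
Proof.
move=> /indepP eA uA; apply: contra (eA u u uA uA) => Bu.
by rewrite /conflict [u == u]eqxx Bu !orbT.
Qed.

Lemma indep_extend z B t a : t \in faces (indep (conflict z B)) ->
  ~~ central a.2 -> ~~ B a.2 ->
  (forall v, v \in t -> v.1 = a.1 -> v.2 = a.2.+1 :> nat \/ v.2.+1 = a.2 ->
     (z -> 0 < v.2) -> False) ->
  a |: t \in faces (indep (conflict z B)).
Proof.
move=> tK /negPf ca /negPf Ba tP; apply: indepU1 => //.
- exact: conflict_sym.
- rewrite /conflict ca Ba !andbF !orbF; apply/negP => /and3P[_ + _].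
  by lia.
- move=> v vt; rewrite /conflict ca andbF /=.
  have [<-|_] := eqVneq a v; first by rewrite Ba orbF; apply/negP=> /and3P[_ + _]; lia.
  rewrite orbF; apply/negP => /and3P[/eqP av1 av2 az].
  apply: (tP v) => //; first by lia.
  by move=> zt; move: az; rewrite zt => /andP[].
Qed.

Definition third_edge (k : nat) (x : 'I_n * 'I_k) : {set W} :=
  [set edge_at x.1 (3 * x.2 + 3)].

(** The apex e_(3q+1) has the neighbours e_(3q), which is deleted at an earlier
    rank (or harmless if q = 0), and e_(3q+2), which cannot occur in a face that
    contains e_(3q+3). *)
Lemma fold_third_edges (B : pred 'I_m) k : 3 * k < m ->
  (forall j, B j -> central j) ->
  equivalent R (realization R (indep (conflict true B)))
    (realization R (avoid_all (indep (conflict true B)) (@third_edge k))).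
Proof.
move=> km Bc.
apply: (@collapse_family R _ _ _ (@third_edge k)
          (fun x => edge_at x.1 (3 * x.2 + 1))
          (fun x => x.2 : nat)).
- by move=> x; apply/set0Pn; exists (edge_at x.1 (3 * x.2 + 3)); rewrite inE.
- move=> [i q] [i' q']; rewrite inE /=; have qk := ltn_ord q.
  have qk' := ltn_ord q'; apply/eqP => /(congr1 (fun u => nat_of_ord u.2)).
  by rewrite !edge_at2; lia.
- move=> [i q] t tK st tq; have qk := ltn_ord q.
  have a2 : (edge_at i (3 * q + 1)).2 = 3 * q + 1 :> nat by apply: edge_at2; lia.
  have s2 : (edge_at i (3 * q + 3)).2 = 3 * q + 3 :> nat by apply: edge_at2; lia.
  have ca : ~~ central (edge_at i (3 * q + 1)).2 by rewrite /central a2; lia.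
  apply: indep_extend => //; first by apply: contra ca; exact: Bc.
  have st' : edge_at i (3 * q + 3) \in t by apply: (fintype.subsetP st); rewrite inE.
  move=> v vt v1; rewrite a2 => v2 vz.
  case: v2 => v2.
    by apply: (indep_path tK vt st'); rewrite ?v2 ?s2//; lia.
  have q0 : 0 < q by have := vz isT; lia.
  have q1k : q.-1 < k by lia.
  have := tq (i, Ordinal q1k); rewrite /= => /(_ ltac:(lia))/negP; apply.
  apply/fintype.subsetP => w; rewrite inE => /eqP ->; rewrite /=.
  by rewrite -(@edge_atE v i (3 * q.-1 + 3))//; lia.
Qed.

End Windmill.

(** * Preparing the folding *)

Section Unlinking.
Variables (R : realType) (m n : nat).
Hypothesis m3 : 3 <= m.
Local Notation W := ('I_n * 'I_m)%type.
Local Notation edge_at := (@edge_at m n m3).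
Implicit Types (u v : W) (t : {set W}).

(** Indices in [l] that are not less than m select nothing.  In each of the three
    families of collapses below the last index runs out of range at q = k - 1, so
    that the last collapse deletes all faces containing the edges named first. *)
Definition edges_at (i : 'I_n) (l : seq nat) : {set W} :=
  [set u | (u.1 == i) && (val u.2 \in l)].

Lemma edge_at_mem i j l : j < m -> (edge_at i j \in edges_at i l) = (j \in l).
Proof. by move=> jm; rewrite inE eqxx -[val _]/(nat_of_ord _) edge_at2. Qed.

Lemma edges_at_sub i l t : (forall j, j \in l -> j < m -> edge_at i j \in t) ->
  edges_at i l \subset t.
Proof.
move=> lt; apply/fintype.subsetP => u; rewrite inE => /andP[/eqP ui ul].
have um := ltn_ord u.2.
by rewrite (@edge_atE _ _ m3 u i u.2)//; apply: lt.
Qed.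

Lemma edges_at_mem i l t j : edges_at i l \subset t -> j \in l -> j < m ->
  edge_at i j \in t.
Proof. by move=> /fintype.subsetP lt jl jm; apply: lt; rewrite edge_at_mem. Qed.

Lemma conflict_weak z B u v : @conflict m n true B u v -> @conflict m n z B u v.
Proof.
rewrite /conflict => /or3P[/and3P[-> -> /= ->]|->|->]; rewrite ?orbT//.
by rewrite implybT.
Qed.

(** Dropping the conflict enlarges the complex, and the larger complex is
    collapsed onto the smaller one.  In the link of the set of e_0 and e_1, the
    edges e_(3q+5) are deleted with apex e_(3q+3); finally e_(3k) can be added
    to every face left, as e_(3k+1) is central and conflicts with e_0. *)
Lemma unlink_2mod3 k : m = 3 * k + 2 ->
  equivalent R (realization R (indep (@conflict m n true pred0)))
               (realization R (indep (@conflict m n false pred0))).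
Proof.
move=> mE; pose s (x : 'I_n * 'I_k) := edges_at x.1 [:: 0; 1; 3 * x.2 + 5].
rewrite (_ : indep (@conflict m n false _) =
    avoid_all (indep (@conflict m n true pred0)) s).
  apply: (@collapse_family R _ _ _ s (fun x => edge_at x.1 (3 * x.2 + 3))
            (fun x => x.2 : nat)).
  - by move=> x; apply/set0Pn; exists (edge_at x.1 0); rewrite edge_at_mem//; lia.
  - move=> [i q] [i' q']; have qk := ltn_ord q; have qk' := ltn_ord q'.
    by rewrite inE /= -[val _]/(nat_of_ord (edge_at i (3 * q + 3)).2) edge_at2 ?inE; lia.
  - move=> [i q] t tK st tq; have qk := ltn_ord q.
    have a2 : (edge_at i (3 * q + 3)).2 = 3 * q + 3 :> nat by apply: edge_at2; lia.
    have t0 : edge_at i 0 \in t by apply: (edges_at_mem st); rewrite ?inE; lia.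
    have t1 : edge_at i 1 \in t by apply: (edges_at_mem st); rewrite ?inE; lia.
    have v0 : (edge_at i 0).2 = 0 :> nat by apply: edge_at2; lia.
    have v1 : (edge_at i 1).2 = 1 :> nat by apply: edge_at2; lia.
    apply: indep_extend => //; first by rewrite /central a2; lia.
    move=> v vt vi; rewrite a2 => -[v2|v2] _.
      have [q1|q1] := ltnP q.+1 k.
        have t5 : edge_at i (3 * q + 5) \in t.
          by apply: (edges_at_mem st); rewrite ?inE ?eqxx ?orbT//; lia.
        have v5 : (edge_at i (3 * q + 5)).2 = 3 * q + 5 :> nat by apply: edge_at2; lia.
        by apply: (indep_path tK vt t5 vi); rewrite ?v5 v2; lia.
      have E : v = edge_at i 0.
        by apply: (indep_central tK vt t0); rewrite /central ?v0 ?v2; lia.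
      by move: v0; rewrite -E; lia.
    have [q0|q0] := posnP q.
      by apply: (indep_path tK t1 vt); rewrite ?v1//; lia.
    have q1k : q.-1 < k by lia.
    have := tq (i, Ordinal q1k); rewrite /= => /(_ ltac:(lia))/negP; apply.
    apply: edges_at_sub => j; rewrite !inE /= => /or3P[]/eqP -> // _.
    by rewrite -(@edge_atE _ _ m3 v i)//; lia.
apply: simplicial_complex_eq => t; apply/idP/avoid_allP => [tK|[/indepP tK ts]].
  split.
    move/indepP: tK => tK; apply/indepP => u v ut vt; apply: contra (tK u v ut vt).
    exact: conflict_weak.
  move=> x; apply/negP => st.
  have t0 : edge_at x.1 0 \in t by apply: (edges_at_mem st); rewrite ?inE; lia.
  have t1 : edge_at x.1 1 \in t by apply: (edges_at_mem st); rewrite ?inE; lia.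
  by apply: (indep_path tK t0 t1); rewrite ?edge_at2//; lia.
have ts' i : ~ (edge_at i 0 \in t /\ edge_at i 1 \in t).
  move=> [t0 t1]; have k1 : k.-1 < k by lia.
  have /negP := ts (i, Ordinal k1); apply; apply: edges_at_sub => j.
  rewrite !inE => /or3P[]/eqP -> /= jm; [exact: t0|exact: t1|exfalso; lia].
apply/indepP => -[i a] [i' b] ut vt; apply: contra (tK _ _ ut vt).
rewrite /conflict /= => /or3P[/and3P[/eqP ii' ab _]|->|->]; rewrite ?orbT//.
subst i'; rewrite eqxx ab.
have ts0 (c d : 'I_m) : (i, c) \in t -> (i, d) \in t -> c = 0 :> nat ->
    d = 1 :> nat -> False.
  move=> ct dt c0 d1; apply: (ts' i); rewrite -(@edge_atE _ _ m3 (i, c) i 0)//; last by lia.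
  by rewrite -(@edge_atE _ _ m3 (i, d) i 1)//; lia.
case: (posnP a) => a0.
  by exfalso; apply: (ts0 _ _ ut vt) => //; lia.
case: (posnP b) => b0 //.
by exfalso; apply: (ts0 _ _ vt ut) => //; lia.
Qed.

(** In the link of e_0, the edges e_(3q+4) are deleted with apex e_(3q+2); finally
    e_(3k-1) can be added to every face left, as e_(3k) is central. *)
Lemma unlink_1mod3 k : m = 3 * k + 1 ->
  equivalent R (realization R (indep (@conflict m n false pred0)))
    (realization R (indep (@conflict m n true (fun j : 'I_m => j == 0 :> nat)))).
Proof.
move=> mE; pose s (x : 'I_n * 'I_k) := edges_at x.1 [:: 0; 3 * x.2 + 4].
rewrite (_ : indep (@conflict m n true _) =
    avoid_all (indep (@conflict m n false pred0)) s).
  apply: (@collapse_family R _ _ _ s (fun x => edge_at x.1 (3 * x.2 + 2))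
            (fun x => x.2 : nat)).
  - by move=> x; apply/set0Pn; exists (edge_at x.1 0); rewrite edge_at_mem//; lia.
  - move=> [i q] [i' q']; have qk := ltn_ord q; have qk' := ltn_ord q'.
    by rewrite inE /= -[val _]/(nat_of_ord (edge_at i (3 * q + 2)).2) edge_at2 ?inE; lia.
  - move=> [i q] t tK st tq; have qk := ltn_ord q.
    have a2 : (edge_at i (3 * q + 2)).2 = 3 * q + 2 :> nat by apply: edge_at2; lia.
    have t0 : edge_at i 0 \in t by apply: (edges_at_mem st); rewrite ?inE; lia.
    have v0 : (edge_at i 0).2 = 0 :> nat by apply: edge_at2; lia.
    apply: indep_extend => //; first by rewrite /central a2; lia.
    move=> v vt vi; rewrite a2 => -[v2|v2] _.
      have [q1|q1] := ltnP q.+1 k.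
        have t4 : edge_at i (3 * q + 4) \in t.
          by apply: (edges_at_mem st); rewrite ?inE ?eqxx ?orbT//; lia.
        have v4 : (edge_at i (3 * q + 4)).2 = 3 * q + 4 :> nat by apply: edge_at2; lia.
        by apply: (indep_path tK vt t4 vi); rewrite ?v4 v2; lia.
      have E : v = edge_at i 0.
        by apply: (indep_central tK vt t0); rewrite /central ?v0 ?v2; lia.
      by move: v0; rewrite -E; lia.
    have [q0|q0] := posnP q.
      by apply: (indep_path tK t0 vt); rewrite ?v0//; lia.
    have q1k : q.-1 < k by lia.
    have := tq (i, Ordinal q1k); rewrite /= => /(_ ltac:(lia))/negP; apply.
    apply: edges_at_sub => j; rewrite !inE /= => /orP[]/eqP -> // _.
    by rewrite -(@edge_atE _ _ m3 v i)//; lia.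
apply: simplicial_complex_eq => t; apply/idP/avoid_allP => [tK|[tK ts]].
  have n0 i : edge_at i 0 \notin t.
    by apply/negP => /(indep_excluded tK); rewrite edge_at2//; lia.
  split; last first.
    move=> x; apply/negP => st; have /negP := n0 x.1; apply.
    by apply: (edges_at_mem st); rewrite ?inE//; lia.
  move/indepP: tK => tK; apply/indepP => u v ut vt; apply: contra (tK u v ut vt).
  have u0 : 0 < u.2.
    rewrite lt0n; apply/negP => /eqP u0; have /negP := n0 u.1; apply.
    by rewrite -(@edge_atE _ _ m3 u u.1 0)//; lia.
  have v0 : 0 < v.2.
    rewrite lt0n; apply/negP => /eqP v0; have /negP := n0 v.1; apply.
    by rewrite -(@edge_atE _ _ m3 v v.1 0)//; lia.
  by rewrite /conflict u0 v0 /= andbF orbF => /orP[->|->]; rewrite ?orbT.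
have n0 i : edge_at i 0 \notin t.
  apply/negP => t0; have k1 : k.-1 < k by lia.
  have /negP := ts (i, Ordinal k1); apply; apply: edges_at_sub => j.
  rewrite !inE => /orP[]/eqP -> /= jm; [exact: t0|exfalso; lia].
move/indepP: tK => tK; apply/indepP => u v ut vt; apply: contra (tK u v ut vt).
rewrite /conflict => /or3P[/and3P[-> ->]//|->|/andP[_ /eqP u0]]; rewrite ?orbT//.
by have /negP := n0 u.1; case; rewrite -(@edge_atE _ _ m3 u u.1 0)//; lia.
Qed.

End Unlinking.

Section Folded.
Variables (R : realType) (m n : nat).
Hypothesis m3 : 3 <= m.
Local Notation W := ('I_n * 'I_m)%type.
Local Notation edge_at := (@edge_at m n m3).
Implicit Types (u v : W) (t : {set W}).

(** In the link of a central edge no other central edge survives, so another copy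
    is reduced to the path e_1, ..., e_(3k-2).  There the edges e_(3q+3) are
    deleted with apex e_(3q+1), until e_(3k-2) can be added to every face. *)
Lemma unlink_0mod3 k : m = 3 * k -> 2 <= n ->
  equivalent R (realization R (indep (@conflict m n false pred0)))
    (realization R (indep (@conflict m n true (@central m)))).
Proof.
move=> mE n2.
have [nx nxP] : exists nx : 'I_n -> 'I_n, forall i, nx i != i.
  have n0 : 0 < n by lia.
  exists (fun i => if i == Ordinal n0 then Ordinal n2 else Ordinal n0) => i.
  by case: (eqVneq i (Ordinal n0)) => [->|]//; rewrite eq_sym.
pose c (b : bool) := if b then 0 else m.-1.
have c_lt b : c b < m by rewrite /c; case: b; lia.
pose s (x : ('I_n * bool) * 'I_k) :=
  edges_at m x.1.1 [:: c x.1.2] :|: edges_at m (nx x.1.1) [:: 3 * x.2 + 3].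
have s_c x t : s x \subset t -> edge_at x.1.1 (c x.1.2) \in t.
  rewrite finset.subUset => /andP[st _].
  by apply: (edges_at_mem _ st); rewrite ?inE.
have s_nx x t : s x \subset t -> 3 * x.2 + 3 < m ->
    edge_at (nx x.1.1) (3 * x.2 + 3) \in t.
  rewrite finset.subUset => /andP[_ st] qm.
  by apply: (edges_at_mem _ st); rewrite ?inE.
have s_sub (x : ('I_n * bool) * 'I_k) t : edge_at x.1.1 (c x.1.2) \in t ->
    (3 * x.2 + 3 < m -> edge_at (nx x.1.1) (3 * x.2 + 3) \in t) -> s x \subset t.
  move=> tc tn; rewrite finset.subUset; apply/andP; split.
    by apply: (edges_at_sub (m3 := m3)) => j; rewrite inE => /eqP ->.
  by apply: (edges_at_sub (m3 := m3)) => j; rewrite inE => /eqP ->.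
have cc i b : central (edge_at i (c b)).2.
  by rewrite /central edge_at2 // /c; case: b; lia.
rewrite (_ : indep (@conflict m n true _) =
    avoid_all (indep (@conflict m n false pred0)) s).
  apply: (@collapse_family R _ _ _ s (fun x => edge_at (nx x.1.1) (3 * x.2 + 1))
            (fun x => x.2 : nat)).
  - move=> x; apply/set0Pn; exists (edge_at x.1.1 (c x.1.2)).
    by apply: (s_c x); exact: subxx.
  - move=> [[i b] q] [[i' b'] q']; have qk := ltn_ord q; have qk' := ltn_ord q'.
    have a2 : (edge_at (nx i) (3 * q + 1)).2 = 3 * q + 1 :> nat by apply: edge_at2; lia.
    rewrite !inE /= -[val _]/(nat_of_ord (edge_at (nx i) (3 * q + 1)).2) a2.
    by rewrite /c; case: b'; lia.
  - move=> [[i b] q] t tK st tq; have qk := ltn_ord q.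
    have a2 : (edge_at (nx i) (3 * q + 1)).2 = 3 * q + 1 :> nat by apply: edge_at2; lia.
    have tc : edge_at i (c b) \in t by exact: (s_c _ _ st).
    have noc v : v \in t -> v.1 = nx i -> ~~ central v.2.
      move=> vt vi; apply/negP => cv; have E := indep_central tK vt tc cv (cc i b).
      by move: (nxP i); rewrite -vi E eqxx.
    apply: indep_extend => //; first by rewrite /central a2; lia.
    move=> v vt vi; rewrite a2 => -[v2|v2] _.
      have [q1|q1] := ltnP q.+1 k; last first.
        have /negP := noc v vt vi; apply; rewrite /central v2; lia.
      have t3 : edge_at (nx i) (3 * q + 3) \in t by apply: (s_nx _ _ st) => /=; lia.
      have v3 : (edge_at (nx i) (3 * q + 3)).2 = 3 * q + 3 :> nat by apply: edge_at2; lia.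
      by apply: (indep_path tK vt t3 vi); rewrite ?v3 v2; lia.
    have [q0|q0] := posnP q.
      have /negP := noc v vt vi; apply; rewrite /central; lia.
    have q1k : q.-1 < k by lia.
    have := tq (i, b, Ordinal q1k); rewrite /= => /(_ ltac:(lia))/negP; apply.
    apply: s_sub => //= _.
    by rewrite -(@edge_atE _ _ m3 v (nx i) (3 * q.-1 + 3))//; lia.
apply: simplicial_complex_eq => t; apply/idP/avoid_allP => [tK|[tK ts]].
  split; last first.
    move=> x; apply/negP => /s_c /(indep_excluded tK).
    by rewrite cc.
  have tc u : u \in t -> 0 < u.2.
    move=> /(indep_excluded tK); rewrite /central negb_or => /andP[+ _].
    by rewrite lt0n.
  move/indepP: (tK) => tK'; apply/indepP => u v ut vt; apply: contra (tK' u v ut vt).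
  have u0 := tc u ut; have v0 := tc v vt.
  by rewrite /conflict u0 v0 /= andbF orbF => /orP[->|->]; rewrite ?orbT.
have nc u : u \in t -> ~~ central u.2.
  move=> ut; apply/negP => cu; have k1 : k.-1 < k by lia.
  have [b ub] : exists b, u = edge_at u.1 (c b).
    case/orP: cu => /eqP u2; [exists true|exists false]; apply: edge_atE => //.
    by rewrite /c; lia.
  have /negP := ts (u.1, b, Ordinal k1); apply; apply: s_sub => /=.
    by rewrite -ub.
  by move=> qm; exfalso; lia.
move/indepP: (tK) => tK'; apply/indepP => u v ut vt; apply: contra (tK' u v ut vt).
rewrite /conflict => /or3P[/and3P[-> ->]//|->|/andP[_ u0]]; rewrite ?orbT//.
by move: (nc u ut); rewrite u0.
Qed.

(** * The complexes left after folding *)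

(** The apex is e_(3k-2) of the first copy: of its neighbours, e_(3k-3) has been
    deleted by the folding, or is central if k = 1, and e_(3k-1) is central. *)
Lemma contractible_0mod3 k : m = 3 * k -> 0 < n ->
  equivalent R (realization R (indep (@conflict m n true (@central m)))) (one_point R).
Proof.
move=> mE n0; pose i0 := Ordinal n0.
have km : 3 * k.-1 < m by lia.
apply: (equivalent_trans (@fold_third_edges R m n m3 (@central m) k.-1 km
  (fun _ c => c))).
apply: (@cone_contractible R _ _ (edge_at i0 (3 * k - 2))).
  apply/avoid_allP; split=> [|x]; first by apply/indepP => u; rewrite inE.
  apply/negP => /fintype.subsetP/(_ (edge_at x.1 (3 * x.2 + 3))).
  by rewrite !inE eqxx => /(_ isT).
move=> t /avoid_allP[tK ts].
have a2 : (edge_at i0 (3 * k - 2)).2 = 3 * k - 2 :> nat by apply: edge_at2; lia.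
have ca : ~~ central (edge_at i0 (3 * k - 2)).2 by rewrite /central a2; lia.
apply/avoid_allP; split=> [|x].
  apply: indep_extend => // v vt vi; rewrite a2 => v2 _.
  have /negP := indep_excluded tK vt.
  rewrite /central; case: v2 => v2; first by apply; lia.
  have [k1 _|k1] := ltnP 1 k; last by apply; lia.
  have qk : k - 2 < k.-1 by lia.
  have /negP := ts (v.1, Ordinal qk); apply.
  rewrite /third_edge finset.sub1set /= -(@edge_atE _ _ m3 v v.1 (3 * (k - 2) + 3))//; lia.
case: x => i q; have qk := ltn_ord q; apply/negP.
rewrite /third_edge finset.sub1set !inE => /orP[/eqP|xt].
  by move/(congr1 (fun u => nat_of_ord u.2)); rewrite a2 edge_at2 /=; lia.
by have /negP := ts (i, q); apply; rewrite /third_edge finset.sub1set.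
Qed.

(** The surviving pair e_(3q+1), e_(3q+2): opposite vertices of the
    cross-polytope on the axis (i, q). *)
Definition pole k (x : 'I_n * 'I_k) (b : bool) : W :=
  edge_at x.1 (3 * x.2 + (if b then 1 else 2)).

Lemma pole2 k x b : 3 * k < m ->
  (@pole k x b).2 = 3 * x.2 + (if b then 1 else 2) :> nat.
Proof. by move=> km; apply: edge_at2; have := ltn_ord x.2; case: b; lia. Qed.

Lemma pole_inj k x y b b' : 3 * k < m -> @pole k x b = @pole k y b' ->
  x = y /\ b = b'.
Proof.
move=> km E; case: x y E => [i q] [i' q'] E.
have Eq := congr1 (fun u => nat_of_ord u.2) E.
move/(congr1 fst): E => /= Ei; move: Eq; rewrite !pole2//= => Eq.
by case: b b' Eq => -[] /= Eq; split=> //; try (exfalso; lia);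
  congr (_, _) => //; apply: val_inj => /=; lia.
Qed.

Lemma conflictP z (B : pred (ordinal m)) u v : conflict z B u v ->
  [\/ [/\ u.1 = v.1, u.2.+1 = v.2 \/ v.2.+1 = u.2 & z -> 0 < u.2 /\ 0 < v.2],
      central u.2 /\ central v.2 | u = v /\ B u.2].
Proof.
move=> /or3P[/and3P[/eqP uv1 uv2 uz]|/and3P[_ cu cv]|/andP[/eqP uv Bu]].
- apply: Or31; split=> //; first by case/orP: uv2 => /eqP; [left|right].
  by move=> zt; move: uz; rewrite zt => /andP[].
- exact: Or32.
- exact: Or33.
Qed.

Lemma pole_conflict k (B : pred (ordinal m)) x y b b' : 3 * k < m ->
  (forall j, B j -> central j) -> conflict true B (@pole k x b) (@pole k y b') ->
  x = y /\ b' = ~~ b.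
Proof.
move=> km Bc; have nc z d : ~~ central (@pole k z d).2.
  by rewrite /central pole2//; have := ltn_ord z.2; case: d; lia.
case/conflictP => [[xy1 + _]|[]|[_ /Bc]]; last 2 first.
- by rewrite (negPf (nc _ _)).
- by rewrite (negPf (nc _ _)).
rewrite !pole2//; case: x y xy1 => [i q] [i' q'] /= -> xy2.
suff [qq ->] : q = q' :> nat /\ b' = ~~ b.
  by split=> //; congr (_, _); exact: val_inj.
by case: b b' xy2 => -[] /=; lia.
Qed.

Lemma third_edge_pole k x b y : 3 * k < m ->
  ~~ (@third_edge m n m3 k y \subset [set @pole k x b]).
Proof.
move=> km; rewrite /third_edge finset.sub1set inE; apply/eqP.
move/(congr1 (fun u => nat_of_ord u.2)); rewrite edge_at2; last first.
  by have := ltn_ord y.2; lia.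
by rewrite pole2//; case: b; lia.
Qed.

(** By the residue of the index modulo 3: residue 0 leaves only e_0, and residue 1
    contains the central edge e_(3k+1) if m = 3k + 2. *)
Lemma pole_cover k u : 3 * k < m -> m <= 3 * k + 2 ->
  (forall x, ~~ (@third_edge m n m3 k x \subset [set u])) ->
  [\/ u.2 = 0 :> nat, m = 3 * k + 2 /\ u.2 = 3 * k + 1 :> nat
    | exists x b, u = @pole k x b].
Proof.
case: u => [i j] km mk th; have jm := ltn_ord j.
have ex b q : q < k -> j = 3 * q + (if b then 1 else 2) :> nat ->
    exists x b, (i, j) = @pole k x b.
  move=> qk jE; exists (i, Ordinal qk), b; apply: edge_atE => //=.
  by case: b {jE}; lia.
have [j0|j0] := posnP j; first exact: Or31.
have jq := divn_eq j 3; have := ltn_pmod j (isT : 0 < 3).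
case: (j %% 3) jq => [|[|[|//]]] jq _.
- have qk : (j %/ 3).-1 < k by lia.
  have /negP[] := th (i, Ordinal qk); rewrite finset.sub1set inE; apply/eqP.
  by symmetry; apply: edge_atE => //=; lia.
- have [qk|qk] := ltnP (j %/ 3) k; last by apply: Or32; split=> /=; lia.
  by apply: Or33; apply: (ex true _ qk); lia.
- have qk : j %/ 3 < k by lia.
  by apply: Or33; apply: (ex false _ qk); lia.
Qed.

End Folded.

Section Models.
Variables (R : realType) (m n : nat).
Hypothesis m3 : 3 <= m.
Local Notation W := ('I_n * 'I_m)%type.
Local Notation edge_at := (@edge_at m n m3).
Implicit Types (u v : W) (t : {set W}).

Definition thinned (B : pred 'I_m) k :=
  avoid_all (indep (@conflict m n true B)) (@third_edge m n m3 k).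

Lemma thinnedP (B : pred 'I_m) k t : reflect
  ((forall u v, u \in t -> v \in t -> ~~ conflict true B u v) /\
   (forall u x, u \in t -> ~~ (@third_edge m n m3 k x \subset [set u])))
  (t \in faces (thinned B k)).
Proof.
apply: (iffP (avoid_allP _ _ _)) => [[/indepP tK ts]|[tK ts]].
  split=> // u x ut; apply: contra (ts x) => xu.
  by apply: fintype.subset_trans xu _; rewrite finset.sub1set.
split; first exact/indepP.
move=> x; apply/negP; rewrite {1}/third_edge.
by rewrite finset.sub1set => /(ts _ x); rewrite subxx.
Qed.

Lemma conflict_diag z (B : pred 'I_m) u : conflict z B u u = B u.2.
Proof.
rewrite /conflict !eqxx /= orbb.
by have -> : (u.2.+1 == u.2) = false by lia.
Qed.

Lemma pole_opposite k B x : 3 * k < m ->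
  conflict true B (@pole m n m3 k x true) (@pole m n m3 k x false).
Proof.
move=> km; rewrite /conflict eqxx !pole2//=; apply/orP; left.
by rewrite addn1 addn2 eqxx.
Qed.

Lemma sphere_1mod3 k : m = 3 * k + 1 -> 0 < n ->
  equivalent R (realization R (thinned (fun j => j == 0 :> nat) k))
    (sphere R (n * k - 1)).
Proof.
move=> mE n0; have km : 3 * k < m by lia.
have Bc (j : 'I_m) : j == 0 :> nat -> central j by rewrite /central => ->.
have nk0 : 0 < n * k by rewrite muln_gt0; lia.
have nk : n * k = (n * k - 1).+1 by lia.
set d := n * k - 1 in nk *.
have [f fbij] : exists f : 'I_d.+1 -> 'I_n * 'I_k, bijective f.
  by apply: ord_enumeration; rewrite card_prod !card_ord.
have finj := bij_inj fbij.
pose e (w : 'I_d.+1 * bool) := @pole m n m3 k (f w.1) w.2.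
have einj : injective e.
  by move=> [x b] [y c] /(pole_inj km) [/= /finj -> ->].
apply: (equivalent_trans (pullback_equivalent R einj _)).
  move=> t u /thinnedP[tK ts] ut.
  case: (pole_cover km _ (fun x => ts u x ut)); first by lia.
  - by move=> u0; move: (tK u u ut ut); rewrite /conflict [u == u]eqxx u0 eqxx !orbT.
  - by lia.
  - move=> [x [b ->]]; have [g _ gK] := fbij.
    by exists (g x, b); rewrite /e /= gK.
apply: cross_polytope_sphere => A; rewrite inE.
apply/thinnedP/forallP => [[tK _] i|AP].
  apply/negP => /andP[iA iA'].
  have /negP := tK _ _ (imset_f e iA) (imset_f e iA'); apply.
  exact: pole_opposite.
split=> [_ _ /imsetP[[x b] xA ->] /imsetP[[y c] yA ->]|_ y /imsetP[[x b] xA ->]].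
  apply/negP => /(pole_conflict km Bc) /= [/finj xy cb]; subst c y.
  by have := AP x; case: b xA yA => /= -> ->.
exact: third_edge_pole.
Qed.

Definition hub_edge k (x : 'I_n * bool) : W :=
  edge_at x.1 (if x.2 then 0 else 3 * k + 1).

Lemma hub_edge2 k x : m = 3 * k + 2 ->
  (hub_edge k x).2 = (if x.2 then 0 else 3 * k + 1) :> nat.
Proof. by move=> mE; apply: edge_at2; case: ifP; lia. Qed.

Lemma hub_edge_central k x : m = 3 * k + 2 -> central (hub_edge k x).2.
Proof. by move=> mE; rewrite /central hub_edge2//; case: x.2; lia. Qed.

Lemma hub_edge_inj k : m = 3 * k + 2 -> injective (hub_edge k).
Proof.
move=> mE x y xy; have := congr1 (fun u => nat_of_ord u.2) xy.
move/(congr1 fst): xy; rewrite !hub_edge2//.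
by case: x y => [i b] [j c] /= ->; case: b c => -[]//; lia.
Qed.

Lemma hub_pole k x y b : m = 3 * k + 2 ->
  (hub_edge k x).2 <> (@pole m n m3 k y b).2 :> nat.
Proof.
move=> mE; rewrite hub_edge2// pole2; last by lia.
by have := ltn_ord y.2; case: x.2; case: b; lia.
Qed.

Lemma hub_pole_conflict k x y b : m = 3 * k + 2 ->
  ~~ conflict true pred0 (hub_edge k x) (@pole m n m3 k y b).
Proof.
move=> mE; have km : 3 * k < m by lia.
have yk := ltn_ord y.2.
apply/negP => /conflictP[[_ + /(_ isT)[]]|[_]|[_]].
- by rewrite hub_edge2// pole2//; case: x.2 => //; case: b; lia.
- by rewrite /central pole2//; case: b; lia.
- by [].
Qed.

Lemma wedge_2mod3 k : m = 3 * k + 2 -> 0 < n ->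
  equivalent R (realization R (thinned pred0 k))
    (wedge_of_spheres R (2 * n - 1) (n * k)).
Proof.
move=> mE n0; have km : 3 * k < m by lia.
have -> : 2 * n - 1 = (2 * n - 2).+1 by lia.
set r := 2 * n - 2; set d := n * k.
have [f fbij] : exists f : 'I_d -> 'I_n * 'I_k, bijective f.
  by apply: ord_enumeration; rewrite card_prod !card_ord.
have [h hbij] : exists h : 'I_r.+2 -> 'I_n * bool, bijective h.
  by apply: ord_enumeration; rewrite card_prod card_ord card_bool /r; lia.
have finj := bij_inj fbij; have hinj := bij_inj hbij.
pose e (w : 'I_r.+2 + 'I_d * bool) :=
  match w with inl j => hub_edge k (h j) | inr v => @pole m n m3 k (f v.1) v.2 end.
have einj : injective e.
  move=> [j|[x b]] [j'|[y c]] /= E.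
  - by congr inl; apply/hinj/(hub_edge_inj mE).
  - by case: (@hub_pole k (h j) (f y) c mE); rewrite E.
  - by case: (@hub_pole k (h j') (f x) b mE); rewrite E.
  - by have [/= /finj -> ->] := pole_inj km E.
apply: (equivalent_trans (pullback_equivalent R einj _)).
  move=> t u /thinnedP[tK ts] ut.
  have hubE b : u.2 = (if b then 0 else 3 * k + 1) :> nat -> exists w, u = e w.
    move=> u2; have [g _ gK] := hbij; exists (inl (g (u.1, b))) => /=.
    by rewrite gK; apply: edge_atE => //=; case: b {u2 gK} => /=; lia.
  case: (pole_cover km _ (fun x => ts u x ut)); first by lia.
  - exact: (hubE true).
  - by move=> [_]; exact: (hubE false).
  - move=> [x [b ->]]; have [g _ gK] := fbij.
    by exists (inr (g x, b)); rewrite /= gK.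
apply: cross_join_wedge => A; rewrite inE.
apply/thinnedP/andP => [[tK _]|[/forallP A1 /forallP A2]].
  split; apply/forallP => i.
    apply/forallP => j; apply/implyP => /andP[iA jA]; apply: contraTT isT => ij.
    have /negP := tK _ _ (imset_f e iA) (imset_f e jA); case.
    rewrite /conflict (inj_eq einj) !hub_edge_central// !andbT; apply/orP; right.
    by apply/orP; left.
  apply/negP => /andP[iA iA'].
  have /negP := tK _ _ (imset_f e iA) (imset_f e iA'); apply.
  exact: pole_opposite.
split=> [_ _ /imsetP[w wA ->] /imsetP[w' wA' ->]|_ y /imsetP[w wA ->]]; last first.
  case: w wA => [j _|[x b] _]; last exact: third_edge_pole.
  rewrite /e /third_edge finset.sub1set inE; apply/eqP.
  move/(congr1 (fun u => nat_of_ord u.2)); have yk := ltn_ord y.2.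
  by rewrite edge_at2 ?hub_edge2//; [case: (h j).2|]; lia.
case: w w' wA wA' => [j|[x b]] [j'|[y c]] wA wA' /=.
- have /forallP/(_ j') := A1 j; rewrite wA wA' => /eqP <-.
  by rewrite conflict_diag.
- exact: hub_pole_conflict.
- by rewrite conflict_sym; exact: hub_pole_conflict.
- apply/negP => /(pole_conflict km) /= [//|/finj xy cb]; subst c y.
  by have := A2 x; case: b wA wA' => /= -> ->.
Qed.

End Models.

(** * The homotopy type of the matching complex *)

(* The case m = 3k needs at least two copies: for n = 1 the windmill graph is
   the cycle C_3k, whose matching complex is not contractible. *)
Theorem theorem30 (R : realType) (m n k : nat)
    (m_ge3 : (3 <= m)%N) (n_ge1 : (1 <= n)%N) :
  let M := realization R (matching_complex (windmill_edges m n)) in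
  [/\ (m = 3 * k)%N -> (2 <= n)%N ->
        homotopy_equivalent R M (one_point R),
      (m = 3 * k + 1)%N ->
        homotopy_equivalent R M (sphere R (n * k - 1)) &
      (m = 3 * k + 2)%N ->
        homotopy_equivalent R M (wedge_of_spheres R (2 * n - 1) (n * k))].
Proof.
have E0 := matching_equivalent R n m_ge3.
split=> [mE n2|mE|mE]; apply: equivalent_homotopy_equivalent;
  apply: (equivalent_trans E0).
- exact: equivalent_trans (unlink_0mod3 R m_ge3 mE n2)
    (contractible_0mod3 R m_ge3 mE n_ge1).
- have km : 3 * k < m by lia.
  apply: (equivalent_trans (unlink_1mod3 R n m_ge3 mE)).
  apply: equivalent_trans (sphere_1mod3 R m_ge3 mE n_ge1).
  by apply: fold_third_edges => // j; rewrite /central => ->.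
- have km : 3 * k < m by lia.
  apply: (equivalent_trans (equivalent_sym (unlink_2mod3 R n m_ge3 mE))).
  apply: equivalent_trans (wedge_2mod3 R m_ge3 mE n_ge1).
  exact: fold_third_edges.
Qed.
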